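(* Let $G$ be an $n$-node, $m$-edge unweighted undirected graph, let $k$ be a positive integer with $k=\widetilde{O}(1)$ (i.e. $k\le\mathrm{polylog}(n)$), and let $\rho=\rho(n)$ be a parameter. There is a randomized algorithm running in $\widetilde{O}(n+m/\rho)$ time that with high probability computes an adjacency oracle for a $(2k-1)$-spanner $H$ of $G$ with $|E(H)|=\widetilde{O}(n^{1+1/k}\rho^2)$.
   Context: A $t$-spanner of $G$ is an edge-subgraph $H$ with $\mathrm{dist}_H(s,t')\le t\cdot\mathrm{dist}_G(s,t')$ for all vertices $s,t'$. The input graph $G$ is given both as an adjacency list (degree, neighbor list and uniformly random neighbor available in $\widetilde{O}(1)$ time per access) and as an adjacency matrix/oracle (edge membership testable in $\widetilde{O}(1)$ time). An adjacency oracle for $H$ is a data structure that, on query $(u,v)$, deterministically returns in $\widetilde{O}(1)$ time a bit indicating whether $(u,v)\in E(H)$; $H$ is fixed at the end of construction. Running time means construction time. $\widetilde{O}$ hides $\mathrm{polylog}(n)$ factors; ''with high probability'' means probability at least $1-1/n^{c}$ for an absolute constant $c>0$.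
   Formalization: The parameter ρ is assumed to be a real number with ρ ≥ 1; without this the claim fails, e.g. for k = 1, G complete and ρ = n^{-0.1}, where the only 1-spanner has Θ(n²) edges. *)

(* Defs.v *)
From HB Require Import structures.
From mathcomp Require Import all_boot all_order all_algebra.
From mathcomp Require Import all_classical all_reals all_analysis.

Set Implicit Arguments.
Unset Strict Implicit.
Unset Printing Implicit Defensive.
Import Order.TTheory GRing.Theory Num.Theory.

Local Open Scope nat_scope.
Local Open Scope classical_set_scope.

(** * Graphs, distances and spanners *)

(* A simple undirected graph on the nodes 0, ..., n-1, together with the
   adjacency lists (in an arbitrary order) through which it is presented. *)
Record graph (n : nat) := Graph {
  adj : rel 'I_n;
  nbrs : 'I_n -> seq 'I_n;
  adj_sym : symmetric adj;
  adj_irr : irreflexive adj;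
  nbrs_uniq : forall u, uniq (nbrs u);
  mem_nbrs : forall u v, (v \in nbrs u) = adj u v }.

Definition edges (T : finType) (e : rel T) : {set {set T}} :=
  [set ([set p.1; p.2])%SET | p in [pred p : T * T | e p.1 p.2]].

(* [path e s p] with [last s p = t] is a walk from s to t with [size p] edges;
   the infimum of the empty set is +oo, for s and t in different components. *)
Definition dist (R : realType) (T : finType) (e : rel T) (s t : T) : \bar R :=
  ereal_inf [set ((size p)%:R)%:E | p in [set p | path e s p /\ last s p = t]].

Definition is_spanner (R : realType) (T : finType) (a : nat) (e h : rel T) :=
  [/\ symmetric h, subrel h e &
      forall s t, (dist R h s t <= (a%:R)%:E * dist R e s t)%E].

(** * A randomized word RAM with access to a graph *)

(* [polylog B n] for a constant B: the factors hidden by the soft-O.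
   (trunc_log 2 n).+1 is the bit length of n > 0; unlike log n it is nonzero
   at n = 1, so the bounds can be required for every n > 0. *)
Definition bitlen (n : nat) : nat := (trunc_log 2 n).+1.
Definition polylog (B n : nat) : nat := B * bitlen n ^ B.

Inductive binop := Add | Sub | Mul | Div | Mod | Eqb | Ltb.

Inductive expr :=
| Cst of nat
| Reg of nat
| Read of expr
| Bin of binop & expr & expr.

Inductive cmd :=
| Skip
| Assign of nat & expr          (* reg x := e *)
| Store of expr & expr          (* mem[e1] := e2 *)
| Rand of nat & expr            (* reg x := uniform in {0, ..., e-1} *)
| Degree of nat & expr          (* reg x := degree of node e *)
| Neighbor of nat & expr & expr (* reg x := e2-th neighbor of node e1 *)
| RandNeighbor of nat & expr    (* reg x := uniform neighbor of node e *)
| TestEdge of nat & expr & expr (* reg x := 1 if e1 e2 is an edge, else 0 *)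
| Seq of cmd & cmd
| If of expr & cmd & cmd
| While of expr & cmd.

Fixpoint rand_free (c : cmd) : bool :=
  match c with
  | Rand _ _ | RandNeighbor _ _ => false
  | Seq c1 c2 | If _ c1 c2 => rand_free c1 && rand_free c2
  | While _ c1 => rand_free c1
  | _ => true
  end.

Record store := MkStore { regs : nat -> nat; mem : nat -> nat }.

(* What remains to be executed, and the store; halted when nothing remains. *)
Definition config : Type := seq cmd * store.

Section Semantics.
(* w is the word length in bits; all arithmetic is modulo 2 ^ w. *)
Variables (w n : nat) (G : graph n).

Definition wrap (x : nat) : nat := x %% 2 ^ w.

(* Subtraction is truncated at 0; x / 0 = 0 and x mod 0 = x. *)
Definition eval_binop (o : binop) (x y : nat) : nat :=
  match o with
  | Add => x + y
  | Sub => x - y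
  | Mul => x * y
  | Div => x %/ y
  | Mod => x %% y
  | Eqb => x == y
  | Ltb => x < y
  end.

Fixpoint eval (s : store) (e : expr) : nat :=
  match e with
  | Cst c => wrap c
  | Reg x => regs s x
  | Read e1 => mem s (eval s e1)
  | Bin o e1 e2 => wrap (eval_binop o (eval s e1) (eval s e2))
  end.

Definition update (f : nat -> nat) (x v : nat) : nat -> nat :=
  fun y => if y == x then wrap v else f y.

Definition set_reg (s : store) (x v : nat) : store :=
  MkStore (update (regs s) x v) (mem s).

Definition set_mem (s : store) (x v : nat) : store :=
  MkStore (regs s) (update (mem s) x v).

(* Words that do not name a node behave as isolated nodes. *)
Definition nbr_words (x : nat) : seq nat :=
  if (insub x : option 'I_n) is Some u then map val (nbrs G u) else [::].

Definition edge_word (x y : nat) : bool :=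
  match (insub x : option 'I_n), (insub y : option 'I_n) with
  | Some u, Some v => adj G u v
  | _, _ => false
  end.

(* A uniform draw from an empty range yields 0. *)
Definition draws (r : seq nat) : seq nat := if r is [::] then [:: 0] else r.

(* The equally likely successors of a configuration. *)
Definition step (cf : config) : seq config :=
  let s := cf.2 in
  match cf.1 with
  | [::] => [::]
  | Skip :: K => [:: (K, s)]
  | Assign x e :: K => [:: (K, set_reg s x (eval s e))]
  | Store e1 e2 :: K => [:: (K, set_mem s (eval s e1) (eval s e2))]
  | Rand x e :: K =>
      [seq (K, set_reg s x v) | v <- draws (iota 0 (eval s e))]
  | Degree x e :: K => [:: (K, set_reg s x (size (nbr_words (eval s e))))]
  | Neighbor x e1 e2 :: K =>
      [:: (K, set_reg s x (nth 0 (nbr_words (eval s e1)) (eval s e2)))]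
  | RandNeighbor x e :: K =>
      [seq (K, set_reg s x v) | v <- draws (nbr_words (eval s e))]
  | TestEdge x e1 e2 :: K =>
      [:: (K, set_reg s x (edge_word (eval s e1) (eval s e2)))]
  | Seq c1 c2 :: K => [:: (c1 :: c2 :: K, s)]
  | If e c1 c2 :: K => [:: ((if eval s e != 0 then c1 else c2) :: K, s)]
  | While e c1 :: K =>
      [:: (if eval s e != 0 then c1 :: While e c1 :: K else K, s)]
  end.

(* Every run from [cf] halts within [t] steps, in a store satisfying [Q]. *)
Fixpoint always (t : nat) (cf : config) (Q : set store) : Prop :=
  if cf.1 is [::] then Q cf.2 else
  if t is t'.+1 then
    forall i, i < size (step cf) -> always t' (nth cf (step cf) i) Q
  else False.

(* The probability that a run from [cf] halts within [t] steps, in a store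
   satisfying [Q]. *)
Fixpoint prob (R : realType) (t : nat) (cf : config) (Q : set store) : R :=
  (if cf.1 is [::] then (cf.2 \in Q)%:R else
   if t is t'.+1 then
     (\sum_(cf' <- step cf) prob R t' cf' Q) / (size (step cf))%:R
   else 0)%R.

(* Parameters too large for a word are replaced by the largest word. *)
Definition saturate (x : nat) : nat := minn x (2 ^ w).-1.

Definition build_input (R : realType) (k : nat) (rho : R) : store :=
  MkStore (fun x => nth 0 [:: saturate n; saturate k;
                              saturate (Num.truncn rho)] x)
          (fun=> 0).

Definition query_input (s : store) (u v : 'I_n) : store :=
  set_reg (set_reg s 0 u) 1 v.

(* Every query starts from the store s left by the construction, so its answer
   does not depend on the queries made before; it is returned in register 0. *)
Definition is_adjacency_oracle (t : nat) (query : cmd) (s : store)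
    (h : rel 'I_n) :=
  rand_free query /\
  forall u v, always t ([:: query], query_input s u v)
                [set s' | regs s' 0 = h u v :> nat].

End Semantics.

(* Main.v *)
Require Import Defs.
From HB Require Import structures.
From mathcomp Require Import all_boot all_order all_algebra.
From mathcomp Require Import all_classical all_reals all_analysis.
From mathcomp Require Import zify ring lra.
Import Order.TTheory GRing.Theory Num.Theory.
Set Implicit Arguments.
Unset Strict Implicit.
Unset Printing Implicit Defensive.
Local Open Scope classical_set_scope.
Local Open Scope ring_scope.

(* Clusters are grown one after the other among the nodes without a cluster:
   from a root, breadth-first layers are added until a layer enlarges the ball
   by a factor of at most q, where n <= q ^ k; this happens at some radius r < k,
   and the ball of radius r becomes the cluster.  Every node is explored once,
   by about (deg / rho) log n random draws from its neighbours instead of by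
   reading its list.  The table entry of (c, y) records which node of cluster c
   discovered y.  An edge xy, where the cluster c of x is not younger than that
   of y, belongs to H if x discovered y for c, or if nobody did.

   The edges along which discoveries were made give a tree of depth < k in every
   cluster, and they number at most q n in all.  If y was discovered for c by
   some other node of c, that edge and the tree join y to x in at most
   1 + 2 (k - 1) steps.  Edges to undiscovered nodes are few: as long as x has u
   such edges, each draw discovers a node with probability u / deg, so after the
   draws of x, with high probability u < (a + 1) rho, where a is the number of
   nodes that x discovered.  Hence H has O(q n rho) edges. *)

(** * Runs with a bounded failure probability *)

Section Runs.
Variables (R : realType) (w n : nat) (G : graph n).
Implicit Types (t : nat) (p : R) (cf : config) (s : store) (X : set store).

(* [p] bounds the probability of failure. *)
Definition good t p cf X :=
  always w G t cf setT /\ 1 - p <= prob w G R t cf X.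

Lemma prob_ge0 t cf X : 0 <= prob w G R t cf X.
Proof.
elim: t cf => [|t IH] [[|c K] s] //=; rewrite divr_ge0 ?ler0n //.
by apply: sumr_ge0 => cf' _; exact: IH.
Qed.

Lemma prob_leS t cf X : prob w G R t cf X <= prob w G R t.+1 cf X.
Proof.
elim: t cf => [|t IH] [[|c K] s] //.
  exact: (prob_ge0 1).
rewrite [X in X <= _]/= [X in _ <= X]/= -/prob.
by apply: ler_wpM2r; rewrite ?invr_ge0 ?ler0n //; apply: ler_sum.
Qed.

Lemma alwaysS t cf X : always w G t cf X -> always w G t.+1 cf X.
Proof.
by elim: t cf => [|t IH] [[|c K] s] // H i lti; apply: IH; exact: H.
Qed.

Lemma good_le t t' p p' cf X :
  good t p cf X -> (t <= t')%N -> p <= p' -> good t' p' cf X.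
Proof.
move=> [H1 H2] le_t le_p; split.
  by rewrite -(subnKC le_t); elim: (t' - t)%N => [|m]; rewrite ?addn0 ?addnS //; exact: alwaysS.
apply: (le_trans (lerB (lexx 1) le_p)); apply: (le_trans H2).
rewrite -(subnKC le_t); elim: (t' - t)%N => [|m IH]; rewrite ?addn0 ?addnS //.
exact: le_trans (prob_leS _ _ _).
Qed.

(** A failure bound of at least 1 claims nothing, so a bad final store only has to force the bound
    up to 1. *)
Lemma good_halt p s X : 0 <= p -> X s \/ 1 <= p -> good 0 p ([::], s) X.
Proof.
move=> p0 H; split=> //=; case: H => H.
  by rewrite (mem_set H) lerBlDr lerDl.
by apply: (@le_trans _ _ 0); [lra|exact: ler0n].
Qed.

Lemma always_det t cf cf' X :
  cf.1 <> [::] -> step w G cf = [:: cf'] -> always w G t cf' X -> always w G t.+1 cf X.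
Proof. by case: cf => [[|c K] s] //= _ E H; rewrite E; case. Qed.

Lemma good_det t p cf cf' X :
  cf.1 <> [::] -> step w G cf = [:: cf'] -> good t p cf' X -> good t.+1 p cf X.
Proof.
move=> K0 E [H1 H2]; split; first exact: always_det H1.
by case: cf K0 E => [[|c K] s] //= _ ->; rewrite big_seq1 divr1.
Qed.

(** The machine's [update] without the reduction modulo 2 ^ w, usable once the new value is known to
    fit in a word. *)
Definition upd (f : nat -> nat) x v y := if y == x then v else f y.

Lemma wrap_small v : (v < 2 ^ w)%N -> Defs.wrap w v = v.
Proof. exact: modn_small. Qed.

Lemma good_skip t p K s X : good t p (K, s) X -> good t.+1 p (Skip :: K, s) X.
Proof. exact: good_det. Qed.

Lemma good_seq t p c1 c2 K s X :
  good t p (c1 :: c2 :: K, s) X -> good t.+1 p (Seq c1 c2 :: K, s) X.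
Proof. exact: good_det. Qed.

Lemma good_assign v t p x e K s X :
  Defs.eval w s e = v -> (v < 2 ^ w)%N ->
  good t p (K, MkStore (upd (regs s) x v) (Defs.mem s)) X ->
  good t.+1 p (Assign x e :: K, s) X.
Proof.
by move=> E lt_v; apply: good_det => //; rewrite /step /= E /set_reg /update wrap_small.
Qed.

Lemma good_store a v t p e1 e2 K s X :
  Defs.eval w s e1 = a -> Defs.eval w s e2 = v -> (v < 2 ^ w)%N ->
  good t p (K, MkStore (regs s) (upd (Defs.mem s) a v)) X ->
  good t.+1 p (Store e1 e2 :: K, s) X.
Proof.
by move=> E1 E lt_v; apply: good_det => //; rewrite /step /= E1 E /Defs.set_mem /update wrap_small.
Qed.

Lemma good_if v t p e c1 c2 K s X :
  Defs.eval w s e = v ->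
  good t p ((if v != 0%N then c1 else c2) :: K, s) X ->
  good t.+1 p (If e c1 c2 :: K, s) X.
Proof. by move=> E; apply: good_det => //; rewrite /step /= E. Qed.

Lemma good_while v t p e c K s X :
  Defs.eval w s e = v ->
  good t p (if v != 0%N then c :: While e c :: K else K, s) X ->
  good t.+1 p (While e c :: K, s) X.
Proof. by move=> E; apply: good_det => //; rewrite /step /= E. Qed.

Lemma nbr_words_ord (u : 'I_n) : nbr_words G u = map val (nbrs G u).
Proof. by rewrite /nbr_words valK. Qed.

Lemma edge_word_ord (u v : 'I_n) : edge_word G u v = adj G u v.
Proof. by rewrite /edge_word !valK. Qed.

Lemma size_nbrs_le (u : 'I_n) : (size (nbrs G u) <= n)%N.
Proof. by rewrite -[X in (_ <= X)%N]card_ord -(card_uniqP (nbrs_uniq G u)) max_card. Qed.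

Lemma good_degree (u : 'I_n) t p x e K s X :
  Defs.eval w s e = u -> (n < 2 ^ w)%N ->
  good t p (K, MkStore (upd (regs s) x (size (nbrs G u))) (Defs.mem s)) X ->
  good t.+1 p (Degree x e :: K, s) X.
Proof.
move=> E ltn; apply: good_det => //; rewrite /step /=.
rewrite E nbr_words_ord size_map /set_reg /update wrap_small //.
exact: leq_ltn_trans (size_nbrs_le u) ltn.
Qed.

(** The failure bound of a uniform draw is the average of the bounds of its outcomes. Random choices
    enter the analysis only here. *)
Lemma good_rand_neighbor (u : 'I_n) (f : 'I_n -> R) t p x e K s X :
  Defs.eval w s e = u -> (n < 2 ^ w)%N -> (0 < size (nbrs G u))%N ->
  (forall y, y \in nbrs G u ->
     good t (f y) (K, MkStore (upd (regs s) x y) (Defs.mem s)) X) ->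
  \sum_(y <- nbrs G u) f y <= p * (size (nbrs G u))%:R ->
  good t.+1 p (RandNeighbor x e :: K, s) X.
Proof.
move=> E ltn dpos Hf Hp.
have Es : step w G (RandNeighbor x e :: K, s) =
    [seq (K, MkStore (upd (regs s) x (val y)) (Defs.mem s)) | y <- nbrs G u].
  rewrite /step /= E nbr_words_ord; have -> : draws (map val (nbrs G u)) = map val (nbrs G u).
    by case: (nbrs G u) dpos.
  rewrite -map_comp; apply: eq_map => y /=.
  by rewrite /set_reg /update wrap_small // (ltn_trans (ltn_ord y)).
split.
  rewrite /always -/always Es => i; rewrite size_map => lti.
  rewrite (nth_map u) //; apply: (proj1 (Hf _ _)); exact: mem_nth.
rewrite /prob -/prob Es size_map big_map ler_pdivlMr ?ltr0n // mulrBl mul1r.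
apply: (@le_trans _ _ (\sum_(y <- nbrs G u) (1 - f y))).
  by rewrite sumrB big_const_seq count_predT iter_addr_0 lerB.
rewrite [X in X <= _]big_seq [X in _ <= X]big_seq; apply: ler_sum => y Hy; exact: (proj2 (Hf y Hy)).
Qed.

End Runs.

(** * The ball growing process *)

Section Algorithm.
Local Open Scope nat_scope.
Variables (n : nat) (G : graph n) (k q rho L : nat).

Definition deg (x : 'I_n) := size (nbrs G x).
(** For rho > 0 the first factor is at least deg / rho, so at least L deg / rho draws are made; it
    vanishes at an isolated node, which has no neighbour to draw. *)
Definition quota (x : 'I_n) := (deg x %/ rho + (0 < deg x)) * L.

(* [sv]: root of the current ball (it is cluster number [sv.+1]); [sq]: the ball
   discovered so far, in order of discovery, whose first [sl] nodes are the
   layers complete so far and first [sh] nodes have been explored; [sx]: the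
   node being explored, with [sd] draws left.  [clu y] is the cluster of y
   (0: none) and [tb c y] is 1 + the node that discovered y for cluster c
   (0: not discovered; a root discovers itself). *)
Record state := State {
  sv : nat; sx : 'I_n; sd : nat; sh : nat; sl : nat; sq : seq 'I_n;
  clu : 'I_n -> nat; tb : nat -> 'I_n -> nat }.

Implicit Type S : state.

Definition set_clu (f : 'I_n -> nat) x v y := if y == x then v else f y.
Definition set_tb (f : nat -> 'I_n -> nat) c x v c' y :=
  if (c' == c) && (y == x) then v else f c' y.

Definition fresh S y := (clu S y == 0) && (tb S (sv S).+1 y == 0).

Definition draw S y :=
  let: State v x d h l Q c T := S in
  if fresh S y
  then State v x d.-1 h l (rcons Q y) c (set_tb T v.+1 y x.+1)
  else State v x d.-1 h l Q c T.

Definition pop S :=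
  let: State v x d h l Q c T := S in
  let z := nth x Q h in
  State v z (quota z) h.+1 l Q (set_clu c z v.+1) T.

Definition extend S :=
  let: State v x d h l Q c T := S in State v x d h (size Q) Q c T.

Definition start S (r : 'I_n) :=
  let: State v x d h l Q c T := S in
  State v x d h 1 [:: r] c (set_tb T v.+1 r v.+1).

Definition advance S :=
  let: State v x d h l Q c T := S in State v.+1 x d 0 0 [::] c T.

(** [j] is only an upper bound on the depth. Every parent has to lie in cluster [i], while [y]
    itself may end up in a younger one, since a discovered node need not be absorbed. *)
Fixpoint descends (c : 'I_n -> nat) (T : nat -> 'I_n -> nat) i j (y : 'I_n) : Prop :=
  if j is j'.+1 then
    descends c T i j' y \/
    exists x : 'I_n, [/\ T i y = x.+1, c x = i, adj G x y & descends c T i j' x]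
  else y.+1 = i.

Definition explored S := \sum_(y : 'I_n) (clu S y != 0).
Definition discoveries S := \sum_(c < n.+1) \sum_(y : 'I_n) (tb S c y != 0).

(** [inv_layer] gives the stretch: r complete layers beyond the root force a ball of size q ^ r,
    which keeps r below k. [inv_count] gives the size: each member of a finished cluster pays for q
    discoveries, and the discoveries of the current ball are paid for by its own size. *)
Record invar S : Prop := Inv {
  inv_v : sv S <= n;
  inv_h : sh S <= sl S;
  inv_l : sl S <= size (sq S);
  inv_uniq : uniq (sq S);
  inv_root : sq S = [::] \/
    exists (r : 'I_n) s, [/\ sv S = r :> nat, sq S = r :: s & 0 < sl S];
  inv_ball : forall y, (y \in sq S) = (tb S (sv S).+1 y != 0);
  inv_cur : forall y, (clu S y == (sv S).+1) = (y \in take (sh S) (sq S));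
  inv_wait : forall y, y \in drop (sh S) (sq S) -> clu S y = 0;
  inv_clu : forall y, clu S y <= (sv S).+1;
  inv_past : forall y : 'I_n, y < sv S -> clu S y <> 0;
  inv_quota : sd S <= quota (sx S);
  inv_x : 0 < sd S -> clu S (sx S) = (sv S).+1;
  inv_future : forall c y, (sv S).+1 < c -> tb S c y = 0;
  inv_parent : forall c y, tb S c y <> 0 -> 0 < c /\
    (y.+1 = c \/ exists x : 'I_n, [/\ tb S c y = x.+1, clu S x = c & adj G x y]);
  inv_member : forall y, clu S y <> 0 ->
    tb S (clu S y) y <> 0 /\ descends (clu S) (tb S) (clu S y) k.-1 y;
  inv_layer : sq S = [::] \/ exists r, [/\ r < k, q ^ r <= sl S,
    forall y, y \in take (sl S) (sq S) -> descends (clu S) (tb S) (sv S).+1 r y &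
    forall y, y \in sq S -> descends (clu S) (tb S) (sv S).+1 r.+1 y];
  inv_count : discoveries S + q * sh S <= q * explored S + size (sq S) }.

(** Chains survive every operation because nonzero cluster numbers and table entries never change;
    [0 < i] rules out the value that stands for no cluster. *)
Lemma descends_ext (c c' : 'I_n -> nat) (T T' : nat -> 'I_n -> nat) i j y :
  0 < i -> (forall x, c x <> 0 -> c' x = c x) ->
  (forall i y, T i y <> 0 -> T' i y = T i y) ->
  descends c T i j y -> descends c' T' i j y.
Proof.
move=> i0 Hc HT; elim: j y => [//|j IH] y /= [H|[x [E1 E2 E3 E4]]].
  by left; apply: IH.
right; exists x; split=> //; last exact: IH.
- by rewrite HT E1.
- by rewrite Hc E2 //; lia.
Qed.

Lemma descends_le c T i j j' y : j <= j' -> descends c T i j y -> descends c T i j' y.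
Proof.
move=> le_j H; rewrite -(subnKC le_j).
by elim: (j' - j) => [|m IH]; rewrite ?addn0 // addnS /=; left.
Qed.

Lemma size_uniq_ord (s : seq 'I_n) : uniq s -> size s <= n.
Proof. by move=> /card_uniqP <-; rewrite -[X in _ <= X]card_ord max_card. Qed.

Lemma sum_set_clu (f : 'I_n -> nat) x v : f x = 0 -> v != 0 ->
  \sum_y (set_clu f x v y != 0) = (\sum_y (f y != 0)).+1.
Proof.
move=> fx v0; rewrite (bigD1 x) // [in RHS](bigD1 x) //= /set_clu !eqxx v0 fx /=.
by rewrite add0n add1n; congr _.+1; apply: eq_bigr => y /negPf ->.
Qed.

Lemma sum_set_tb (T : nat -> 'I_n -> nat) c x v :
  c <= n -> T c x = 0 -> v != 0 ->
  \sum_(i < n.+1) \sum_y (set_tb T c x v i y != 0) =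
  (\sum_(i < n.+1) \sum_y (T i y != 0)).+1.
Proof.
move=> lec Tx v0; have ltc : c < n.+1 by [].
rewrite (bigD1 (Ordinal ltc)) // [in RHS](bigD1 (Ordinal ltc)) //=.
have -> : \sum_y (set_tb T c x v c y != 0) = (\sum_y (T c y != 0)).+1.
  rewrite -(@sum_set_clu (T c) x v) //; apply: eq_bigr => y _.
  by rewrite /set_tb /set_clu eqxx.
rewrite addSn; congr (_ + _).+1; apply: eq_bigr => i /negPf ne.
by apply: eq_bigr => y _; rewrite /set_tb -val_eqE in ne *; rewrite ne.
Qed.

(** The drawing node is explored, hence in a complete layer and of depth at most r, so what it
    discovers has depth at most r + 1. The discovery is paid for by the growth of the queue. *)
Lemma inv_draw S y : invar S -> 0 < sd S -> y \in nbrs G (sx S) -> invar (draw S y).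
Proof.
case: S => v x d h l Q c T [] /= Hv Hh Hl Hu Hr Hb Hc Hw Hclu Hp Hq Hx Hf Hpar Hm Hlay Hn d0.
rewrite mem_nbrs => axy; rewrite /fresh /=.
have cx : c x = v.+1 by exact: Hx.
have xQ : x \in take h Q by rewrite -Hc cx.
have Qn : Q <> [::] by move=> E; rewrite E in xQ.
case: ifP => [/andP[/eqP cy /eqP Ty]|_]; last first.
  by split=> //=; lia.
have yQ : y \notin Q by rewrite Hb Ty.
have HT i z : T i z <> 0 -> set_tb T v.+1 y x.+1 i z = T i z.
  by rewrite /set_tb; case: ifP => // /andP[/eqP -> /eqP ->].
have Hd i j z : 0 < i -> descends c T i j z -> descends c (set_tb T v.+1 y x.+1) i j z.
  by move=> i0; apply: descends_ext.
have szQ : h <= size Q by lia.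
have ltv : v < n.
  by case: Hr => // -[r [s [-> _ _]]].
split=> //=.
- by rewrite size_rcons; lia.
- by rewrite rcons_uniq yQ.
- case: Hr => // -[r [s [E1 E2 E3]]]; right; exists r, (rcons s y); split=> //.
  by rewrite E2.
- by move=> z; rewrite mem_rcons finset.inE Hb /set_tb eqxx /=; case: eqP.
- by move=> z; rewrite Hc -cats1 takel_cat.
- move=> z; rewrite drop_rcons // mem_rcons finset.inE => /orP[/eqP -> //|]; exact: Hw.
- lia.
- move=> i z lti; rewrite /set_tb; case: eqP => [E|_] /=; first by lia.
  exact: Hf.
- move=> i z; rewrite /set_tb; case: ifP => [/andP[/eqP -> /eqP ->] _|_]; last exact: Hpar.
  by split=> //; right; exists x.
- move=> z cz; have [H1 H2] := Hm z cz; split; first by rewrite HT.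
  by apply: Hd => //; lia.
- right; case: Hlay => // -[r [E1 E2 E3 E4]]; exists r; split=> //.
    move=> z; rewrite -cats1 takel_cat // => zQ; apply: Hd => //; exact: E3.
  move=> z; rewrite mem_rcons finset.inE => /orP[/eqP ->|zQ]; last first.
    case: (E4 z zQ) => [H|[x' [F1 F2 F3 F4]]]; first by left; apply: Hd.
    right; exists x'; split=> //; last exact: Hd.
    by rewrite HT F1.
  right; exists x; split=> //; first by rewrite /set_tb !eqxx.
  apply: Hd => //; apply: E3; move: xQ; rewrite -(subnKC Hh) takeD mem_cat => -> //.
- rewrite /discoveries /= sum_set_tb // size_rcons.
  by move: Hn; rewrite /discoveries /explored /=; lia.
Qed.

(** The popped node lies in a complete layer, so its depth is at most r <= k - 1, as membership
    requires. In [inv_count] both [sh] and [explored] rise by one. *)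
Lemma inv_pop S : invar S -> sd S = 0 -> sh S < sl S -> invar (pop S).
Proof.
case: S => v x d h l Q c T [] /= Hv Hh Hl Hu Hr Hb Hc Hw Hclu Hp Hq Hx Hf Hpar Hm Hlay Hn d0 lth.
have szh : h < size Q by lia.
set z := nth x Q h.
have zQ : z \in Q by exact: mem_nth.
have Edrop : drop h Q = z :: drop h.+1 Q by exact: drop_nth.
have cz : c z = 0 by apply: Hw; rewrite Edrop mem_head.
have HC y : c y <> 0 -> set_clu c z v.+1 y = c y.
  by rewrite /set_clu; case: eqP => // ->.
have Hd i j y : 0 < i -> descends c T i j y -> descends (set_clu c z v.+1) T i j y.
  by move=> i0; apply: descends_ext.
have Etake : take h.+1 Q = rcons (take h Q) z by exact: take_nth.
split=> //=.
- move=> y; rewrite Etake mem_rcons finset.inE -Hc /set_clu; case: (y =P z) => //= _.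
  by rewrite eqxx.
- move=> y yd; rewrite /set_clu; case: eqP => [E|_]; last first.
    by apply: Hw; rewrite Edrop finset.inE yd orbT.
  by move: Hu; rewrite -(cat_take_drop h Q) Edrop cat_uniq /= -E yd /= => /and3P[].
- by move=> y; rewrite /set_clu; case: ifP.
- by move=> y lty; rewrite /set_clu; case: eqP => // _; exact: Hp.
- by rewrite /set_clu eqxx.
- move=> i y Ty; case: (Hpar i y Ty) => i0 [|[x' [F1 F2 F3]]]; first by split=> //; left.
  by split=> //; right; exists x'; split=> //; rewrite HC F2 //; lia.
- move=> y; rewrite {1 2}/set_clu; case: (y =P z) => [-> _|_ cy]; last first.
    have [H1 H2] := Hm y cy; rewrite /set_clu; case: eqP => [E|_]; first by rewrite E in cy.
    by split=> //; apply: Hd => //; lia.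
  rewrite /set_clu eqxx; split; first by apply/eqP; rewrite -Hb.
  case: Hlay => [E|[r [E1 E2 E3 E4]]]; first by rewrite E in zQ.
  apply: (@descends_le _ _ _ r); first by lia.
  apply: Hd => //; apply: E3; rewrite -(subnKC lth) takeD mem_cat Etake mem_rcons mem_head //.
- case: Hlay => [E|[r [E1 E2 E3 E4]]]; first by left.
  right; exists r; split=> // y yQ.
    by apply: Hd => //; exact: E3.
  by apply: (Hd _ r.+1) => //; exact: E4.
- by move: Hn; rewrite /explored /= sum_set_clu //; rewrite /discoveries /=; lia.
Qed.

(** Growth by more than the factor q gives q ^ (r + 1) < size Q <= n <= q ^ k, hence r + 1 < k. *)
Lemma inv_extend S : 0 < q -> n <= q ^ k -> invar S -> sh S = sl S -> q * sl S < size (sq S) -> invar (extend S).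
Proof.
move=> qpos qk.
case: S => v x d h l Q c T [] /= Hv Hh Hl Hu Hr Hb Hc Hw Hclu Hp Hq Hx Hf Hpar Hm Hlay Hn eh lts.
split=> //=.
- exact: leq_trans Hl.
- by case: Hr => [|[r [s [E1 E2 E3]]]]; [left|right; exists r, s; split=> //; rewrite E2].
- case: Hlay => [E|[r [E1 E2 E3 E4]]]; first by left.
  have lt1 : q ^ r.+1 < size Q by rewrite expnS (leq_ltn_trans _ lts) // leq_mul2l E2 orbT.
  right; exists r.+1; split=> //.
  + have lt2 : q ^ r.+1 < q ^ k by apply: leq_trans (leq_trans (size_uniq_ord Hu) qk).
    rewrite ltnNge; apply: contraL lt2 => lek; rewrite -leqNgt.
    by rewrite leq_pexp2l.
  + exact: ltnW.
  + by move=> y; rewrite take_size; exact: E4.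
  + by move=> y yQ; left; exact: E4.
Qed.

(** A nonempty ball whose complete layers are all explored has its root in the cluster, so a root
    without a cluster means that no ball has been started. *)
Lemma inv_idle S (r : 'I_n) : invar S -> sh S = sl S -> r = sv S :> nat ->
  clu S r = 0 -> sq S = [::].
Proof.
move=> I eh Er cr; case: (inv_root I) => // -[r' [s [E1 E2 E3]]].
have rr : r' = r by apply: val_inj; rewrite /= Er E1.
have := inv_cur I r; rewrite cr eh E2 -rr; move: E3; case: (sl S) => // l _.
by rewrite /= mem_head.
Qed.

Lemma inv_start S (r : 'I_n) : 0 < k -> invar S -> sd S = 0 -> sh S = sl S -> r = sv S :> nat ->
  clu S r = 0 -> invar (start S r).
Proof.
move=> kpos I d0 eh Er cr; have Eq := inv_idle I eh Er cr.
case: S I d0 eh Er cr Eq => v x d h l Q c T [] /= Hv Hh Hl Hu Hr Hb Hc Hw Hclu Hp Hq Hx Hf Hpar Hm Hlay Hn d0 eh Er cr EQ.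
subst Q; have l0 : l = 0 by move: Hl => /=; lia.
have h0 : h = 0 by lia.
subst l h d; clear Hlay Hr.
have Tv y : T v.+1 y = 0 by have := Hb y; rewrite in_nil => /esym/negbFE/eqP.
have HT i z : T i z <> 0 -> set_tb T v.+1 r v.+1 i z = T i z.
  by rewrite /set_tb; case: ifP => // /andP[/eqP -> /eqP ->]; rewrite Tv.
have Hd i j z : 0 < i -> descends c T i j z -> descends c (set_tb T v.+1 r v.+1) i j z.
  by move=> i0; apply: descends_ext.
split=> //=.
- by right; exists r, [::].
- by move=> y; rewrite finset.inE /set_tb eqxx /=; case: eqP => // _; rewrite Tv.
- by move=> y; rewrite finset.inE => /eqP ->.
- move=> i z lti; rewrite /set_tb; case: eqP => [E|_] /=; first by lia.
  exact: Hf.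
- move=> i z; rewrite /set_tb; case: ifP => [/andP[/eqP -> /eqP ->] _|_]; last exact: Hpar.
  by split=> //; left; rewrite Er.
- move=> z cz; have [H1 H2] := Hm z cz; split; first by rewrite HT.
  by apply: Hd => //; lia.
- right; exists 0; split=> // y; rewrite finset.inE => /eqP ->; last left.
    by rewrite /= Er.
  by rewrite /= Er.
- have ltv : v < n by rewrite -Er.
  rewrite /discoveries /= sum_set_tb // muln0.
  by move: Hn; rewrite /discoveries /explored /=; lia.
Qed.

(** When growth stops, size Q <= q * sl = q * sh, so the explored nodes pay for all discoveries of
    the ball, including the nodes left outside the cluster. *)
Lemma inv_advance S (r : 'I_n) : invar S -> sd S = 0 -> sh S = sl S -> r = sv S :> nat ->
  size (sq S) <= q * sl S -> clu S r <> 0 -> invar (advance S).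
Proof.
case: S => v x d h l Q c T [] /= Hv Hh Hl Hu Hr Hb Hc Hw Hclu Hp Hq Hx Hf Hpar Hm Hlay Hn d0 eh Er szQ cr.
split=> //=.
- by rewrite -Er.
- by left.
- by move=> y; rewrite in_nil Hf.
- by move=> y; rewrite in_nil; apply/negP => /eqP cy; have := Hclu y; rewrite cy ltnn.
- by move=> y; have := Hclu y; lia.
- move=> y; rewrite ltnS leq_eqVlt => /orP[/eqP E|]; last exact: Hp.
  by have -> : y = r by apply: val_inj; rewrite /= Er.
- by rewrite d0.
- by move=> i y lti; apply: Hf; lia.
- by left.
- by move: Hn; rewrite /discoveries /explored /=; rewrite muln0 addn0; nia.
Qed.

End Algorithm.

(** * Failure probability and running time *)

Section Potential.
Variables (R : realType) (n : nat) (G : graph n) (k q rho m : nat).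
Local Notation L := (2 * m)%N.
Local Notation invar := (invar G k q rho L).
Local Notation pop := (pop G rho L).
Implicit Types (S : state n) (A j a u D : nat).

Definition hits S x := (\sum_y (tb S (clu S x) y == x.+1))%N.

(* While x is explored, these are the edges of x that would discover a node. *)
Definition misses S x := (\sum_(y <- nbrs G x)
  (((clu S y == 0) || (clu S x < clu S y)) && (tb S (clu S x) y == 0)))%N.

(* Bounds the probability that, j draws later, x has a <= A hits in total and
   still at least (A + 1) rho misses: until then each draw is a hit with
   probability at least (A + 1) rho / D, and a hit halves the bound. *)
Definition tail_bound A j a u D : R :=
  if (a <= A)%N && (A.+1 * rho <= u)%N
  then 2 ^+ (A - a) * (1 - (A.+1 * rho)%:R / (2 * D)%:R) ^+ j else 0.

(** The bound 2 ^ - m of [tail_bound_start], summed over the n + 1 values of A in [node_pot]. *)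
Definition eps : R := n.+1%:R * (2^-1) ^+ m.

(** An unexplored node is charged in advance for what exploring it may cost. For an explored one,
    the sum is a union bound over its possible final numbers of hits. *)
Definition node_pot S x : R :=
  if clu S x == 0%N then eps else
  \sum_(A < n.+1) tail_bound A (if x == sx S then sd S else 0%N)
                    (hits S x) (misses S x) (deg G x).

Definition pot S : R := \sum_x node_pot S x.

Hypothesis rho0 : (0 < rho)%N.

Lemma tail_base A u D : (A.+1 * rho <= u)%N -> (u <= D)%N ->
  0 <= 1 - (A.+1 * rho)%:R / (2 * D)%:R :> R.
Proof.
move=> H1 H2; rewrite subr_ge0 ler_pdivrMr ?mul1r ?ler_nat ?ltr0n; nia.
Qed.

Lemma tail_bound_ge0 A j a u D : (u <= D)%N -> 0 <= tail_bound A j a u D.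
Proof.
move=> uD; rewrite /tail_bound; case: ifP => // /andP[_ H].
by rewrite mulr_ge0 ?exprn_ge0 ?ler0n // (tail_base H).
Qed.

Lemma tail_bound_le A j a a' u u' D : (a <= a')%N -> (u' <= u)%N -> (u <= D)%N ->
  tail_bound A j a' u' D <= tail_bound A j a u D.
Proof.
move=> aa uu uD; rewrite {1}/tail_bound; case: ifP; last by rewrite tail_bound_ge0.
move=> /andP[H1 H2]; have H3 := leq_trans H2 uu.
rewrite /tail_bound H3 (leq_trans aa H1) /=.
apply: ler_wpM2r; first by rewrite exprn_ge0 // (tail_base H3).
by rewrite ler_eXn2l ?ltr1n // leq_sub2l.
Qed.

Lemma tail_bound_hit A j a a' u u' D : (a < a')%N -> (u' <= u)%N -> (u <= D)%N ->
  tail_bound A j a' u' D <= tail_bound A j a u D / 2.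
Proof.
move=> aa uu uD; rewrite {1}/tail_bound; case: ifP; last first.
  by rewrite divr_ge0 ?ler0n ?tail_bound_ge0.
move=> /andP[H1 H2]; have H3 := leq_trans H2 uu.
rewrite /tail_bound H3 (leq_trans (ltnW aa) H1) /= mulrAC.
apply: ler_wpM2r; first by rewrite exprn_ge0 // (tail_base H3).
by rewrite ler_pdivlMr ?ltr0n // -exprSr ler_eXn2l ?ltr1n //; lia.
Qed.

(** A draw is a hit with probability u / D and then halves the bound, so the expected factor is 1 -
    u / (2 D), which is at most the base of the power because (A + 1) rho <= u. *)
Lemma tail_bound_draw A j a u D : (u <= D)%N -> (0 < D)%N ->
  tail_bound A j a u D * (1 - u%:R / (2 * D)%:R) <= tail_bound A j.+1 a u D.
Proof.
move=> uD D0; rewrite /tail_bound; case: ifP => [/andP[H1 H2]|_]; last by rewrite mul0r.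
rewrite [X in _ <= _ * X]exprSr mulrA; apply: ler_wpM2l.
  by rewrite mulr_ge0 ?exprn_ge0 ?ler0n // (tail_base H2).
by rewrite lerD2l lerN2 ler_wpM2r ?invr_ge0 ?ler0n ?ler_nat.
Qed.

(** The quota is at least 2 m D / rho, so the power is at most exp (- (A + 1) m) <= 2 ^ - (A + 1) m.
    This absorbs the factor 2 ^ A and leaves 2 ^ - m. *)
Lemma tail_bound_start A a u x : (0 < m)%N -> (u <= deg G x)%N ->
  tail_bound A (quota G rho L x) a u (deg G x) <= (2^-1) ^+ m.
Proof.
move=> m0 uD; rewrite /tail_bound; case: ifP => [/andP[H1 H2]|_]; last first.
  by rewrite exprn_ge0 ?invr_ge0 ?ler0n.
have D0 : (0 < deg G x)%N by nia.
have base0 := tail_base H2 uD.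
set b := (1 - _) in base0 *.
have quotaE : (deg G x * L <= rho * quota G rho L x)%N.
  rewrite /quota D0 (mulnA rho) leq_mul2r; apply/orP; right.
  by rewrite addn1 mulnC ltnW // ltn_ceil.
have b_exp : b ^+ quota G rho L x <= expR (- (A.+1 * m)%:R).
  have Hb : b <= expR (- ((A.+1 * rho)%:R / (2 * deg G x)%:R)) by exact: expR_ge1Dx.
  apply: (le_trans (lerXn2r _ _ _ Hb)); rewrite ?nnegrE ?expR_ge0 //.
  rewrite -expRM_natl ler_expR mulrN lerN2 mulrA ler_pdivlMr ?ltr0n; last by lia.
  rewrite -!natrM ler_nat; move: quotaE; move: (quota G rho L x) (deg G x) => Q D; nia.
have e2 : expR (- (A.+1 * m)%:R) <= (2^-1 : R) ^+ (A.+1 * m).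
  rewrite -mulN1r mulrC expRM_natl lerXn2r ?nnegrE ?expR_ge0 ?invr_ge0 ?ler0n //.
  rewrite expRN lef_pV2 ?posrE ?expR_gt0 ?ltr0n //.
  by apply: le_trans (expR_ge1Dx 1); rewrite -natr1.
apply: (@le_trans _ _ (2 ^+ A * (2^-1) ^+ (A.+1 * m))).
  apply: ler_pM; rewrite ?exprn_ge0 ?ler0n //.
    by rewrite ler_eXn2l ?ltr1n // leq_subr.
  exact: le_trans e2.
(* This splitting uses m >= 1: the first A halvings cancel 2 ^ A, the next m remain, and the rest is
   dropped. *)
have -> : (A.+1 * m = A + (m + A * m.-1))%N by nia.
rewrite exprD mulrA -exprMn divff ?pnatr_eq0 // expr1n mul1r.
by rewrite ler_wiXn2l ?invr_ge0 ?ler0n ?invf_le1 ?ler1n ?ltr0n ?leq_addr.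
Qed.

Lemma misses_le S x : (misses S x <= deg G x)%N.
Proof.
rewrite /misses /deg; elim: (nbrs G x) => [|y s IH]; first by rewrite big_nil.
by rewrite big_cons /=; case: (_ && _); lia.
Qed.

Lemma eps_ge0 : 0 <= eps.
Proof. by rewrite mulr_ge0 ?exprn_ge0 ?invr_ge0 ?ler0n. Qed.

Lemma node_pot_ge0 S x : 0 <= node_pot S x.
Proof.
rewrite /node_pot; case: ifP => _; first exact: eps_ge0.
by apply: sumr_ge0 => A _; rewrite tail_bound_ge0 ?misses_le.
Qed.

Lemma hits_le S x : (hits S x <= n)%N.
Proof.
rewrite /hits -[X in (_ <= X)%N]card_ord -sum1_card.
by apply: leq_sum => y _; case: (_ == _).
Qed.

(** With no draws left, the summand with A equal to the actual number of hits is exactly 1. *)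
Lemma pot_bad S x : sd S = 0%N -> clu S x <> 0%N ->
  ((hits S x).+1 * rho <= misses S x)%N -> 1 <= pot S.
Proof.
move=> d0 cx bad; rewrite /pot (bigD1 x) //= -[X in X <= _]addr0 lerD //; last first.
  by apply: sumr_ge0 => y _; exact: node_pot_ge0.
rewrite /node_pot (negPf (introN eqP cx)) d0 if_same.
have lth : (hits S x < n.+1)%N by rewrite ltnS hits_le.
rewrite (bigD1 (Ordinal lth)) //= /tail_bound leqnn bad /= subnn !expr0 mul1r.
rewrite -[X in X <= _]addr0 lerD //; apply: sumr_ge0 => A _.
exact/tail_bound_ge0/misses_le.
Qed.

(** The potential is a supermartingale: at other nodes hits stay the same and misses do not grow,
    while at the drawing node each summand obeys [tail_bound_draw]. *)
Lemma pot_draw S : invar S -> (0 < sd S)%N ->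
  \sum_(y <- nbrs G (sx S)) pot (draw S y) <= pot S * (deg G (sx S))%:R.
Proof.
move=> I d0; have cx := inv_x I d0.
have D0 : (0 < deg G (sx S))%N.
  have := leq_trans d0 (inv_quota I); rewrite /quota; case: (deg G _) => //.
  by rewrite div0n.
set x := sx S in cx D0 *.
pose rest := \sum_(z | z != x) node_pot S z.
pose mb A := tail_bound A (sd S).-1 (hits S x) (misses S x) (deg G x).
have cluE y z : clu (draw S y) z = clu S z.
  by rewrite /draw; case: (S) => *; case: ifP.
have sxE y : sx (draw S y) = x by rewrite /x /draw; case: (S) => *; case: ifP.
have sdE y : sd (draw S y) = (sd S).-1 by rewrite /draw; case: (S) => *; case: ifP.
have tbE y i z : tb (draw S y) i z =
    if fresh S y then set_tb (tb S) (sv S).+1 y x.+1 i z else tb S i z.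
  by rewrite /draw /x; case: (S) => * /=; case: ifP.
have miss_le y z : (misses (draw S y) z <= misses S z)%N.
  rewrite /misses; apply: leq_sum => y' _; rewrite !cluE tbE.
  case: (_ || _) => //=; case: ifP => // _; rewrite /set_tb; case: ifP => //.
have hit_eq y z : z != x -> hits (draw S y) z = hits S z.
  move=> zx; apply: eq_bigr => y' _; rewrite cluE tbE; case: ifP => // /andP[_ /eqP T0].
  rewrite /set_tb; case: ifP => // /andP[/eqP E1 /eqP E2].
  by rewrite E1 E2 T0 !eqSS val_eqE eq_sym (negPf zx).
have hit_ge y : (hits S x + fresh S y <= hits (draw S y) x)%N.
  case Ef: (fresh S y); last first.
    rewrite addn0; apply: leq_sum => y' _; by rewrite cluE tbE Ef.
  have /andP[_ /eqP T0] := Ef.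
  rewrite /hits (bigD1 y) //= [X in (_ <= X)%N](bigD1 y) //= cluE !tbE Ef cx T0.
  rewrite /set_tb !eqxx /= addnC add0n leq_add2l.
  by apply: leq_sum => y' /negPf ne; rewrite tbE Ef /set_tb ne andbF.
have step_le y : pot (draw S y) <= rest + \sum_(A < n.+1) mb A * (1 - (fresh S y)%:R / 2).
  rewrite /pot (bigD1 x) //= addrC lerD //.
    apply: ler_sum => z zx; rewrite /node_pot cluE sxE -/x (negPf zx).
    case: ifP => // _; apply: ler_sum => A _; apply: tail_bound_le => //; last exact: misses_le.
    by rewrite hit_eq.
  rewrite /node_pot cluE cx /= sxE eqxx sdE; apply: ler_sum => A _.
  have := hit_ge y; case: (fresh S y) => /= H.
    apply: le_trans (tail_bound_hit _ _ _ (miss_le y x) (misses_le _ _)) _; first by rewrite -addn1; exact: H.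
    by rewrite -/(mb A); lra.
  rewrite mul0r subr0 mulr1; apply: tail_bound_le => //; last exact: misses_le.
  by rewrite -[X in (X <= _)%N]addn0.
(* The current cluster is the newest, so no neighbour lies in a younger one and the misses are
   precisely the fresh neighbours. *)
have freshE : (\sum_(y <- nbrs G x) fresh S y)%N = misses S x.
  rewrite /misses; apply: eq_bigr => y _; rewrite cx /fresh.
  by rewrite (ltnNge _ (clu S y)) (inv_clu I) orbF.
apply: (@le_trans _ _ (\sum_(y <- nbrs G x) (rest + \sum_(A < n.+1) mb A * (1 - (fresh S y)%:R / 2)))).
  by apply: ler_sum => y _; exact: step_le.
rewrite big_split /= big_const_seq count_predT iter_addr_0 exchange_big /=.
rewrite /pot (bigD1 x) //= -/rest [X in _ <= X * _]addrC mulrDl mulr_natr lerD //.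
rewrite /node_pot cx /= eqxx mulr_suml; apply: ler_sum => A _.
rewrite -mulr_sumr sumrB big_const_seq count_predT iter_addr_0 -mulr_suml -natr_sum freshE.
have := tail_bound_draw A (sd S).-1 (hits S x) (misses_le S x) D0.
rewrite prednK // -/(mb A) => H.
apply: le_trans (ler_wpM2r _ H); rewrite ?ler0n //.
rewrite -mulrA mulrBl mul1r natrM invfM mulrA mulfVK // pnatr_eq0 -lt0n //.
Qed.

(** The popped node trades its advance [eps] for n + 1 tail bounds of at most 2 ^ - m each. It
    creates no miss elsewhere, since without a cluster it already counted as a possible one. *)
Lemma pot_pop S : (0 < m)%N -> invar S -> sd S = 0%N -> (sh S < sl S)%N ->
  pot (pop S) <= pot S.
Proof.
move=> m0 I d0 lth.
have szh : (sh S < size (sq S))%N by exact: leq_trans (inv_l I).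
have cz : clu S (nth (sx S) (sq S) (sh S)) = 0%N.
  by apply: (inv_wait I); rewrite (drop_nth (sx S)) // mem_head.
case: S I d0 lth szh cz => v x d h l Q c T /= I d0 lth szh cz.
move: cz; set z := nth x Q h => cz; apply: ler_sum => y _; rewrite /node_pot /= -/z d0 if_same.
rewrite {1}/set_clu; case: (y =P z) => [->|ne] /=.
  rewrite cz eqxx /= /eps mulr_natl -[X in _ *+ X]card_ord -sumr_const; apply: ler_sum => A _.
  by apply: tail_bound_start => //; exact: misses_le.
case: ifP => // cy; apply: ler_sum => A _; apply: tail_bound_le.
- by apply: leq_sum => y' _; rewrite /= /set_clu; case: (y =P z).
- apply: leq_sum => y' _ /=; rewrite /set_clu; case: (y =P z) => // _.
  case: (y' =P z) => [->|_] //; rewrite cz /=; case: (_ == _) => //; by rewrite ?andbT ?andbF; case: (_ < _)%N.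
- exact: misses_le.
Qed.

Lemma pot_extend S : pot (extend S) = pot S.
Proof. by case: S. Qed.

Lemma pot_advance S : pot (advance S) = pot S.
Proof. by case: S. Qed.

(** The new entry lies in the row of a cluster that has no member yet, and hits and misses read only
    the rows of clusters with members. *)
Lemma pot_start S (r : 'I_n) : invar S -> sh S = sl S -> r = sv S :> nat -> clu S r = 0%N ->
  pot (start S r) = pot S.
Proof.
move=> I eh Er cr; have E0 := inv_idle I eh Er cr.
have H y : clu S y != (sv S).+1 by rewrite (inv_cur I) E0.
case: S {I eh E0 Er cr} H => v x d h l Q c T /= H; apply: eq_bigr => y _.
rewrite /node_pot /=; case: ifP => // _; apply: eq_bigr => A _; congr tail_bound.
  by apply: eq_bigr => y' _ /=; rewrite /set_tb (negPf (H y)).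
by apply: eq_bigr => y' _ /=; rewrite /set_tb (negPf (H y)).
Qed.

End Potential.

(** * Bounding the number of iterations *)

Section Budget.
Local Open Scope nat_scope.
Variables (n : nat) (G : graph n) (k q rho L : nat).
Local Notation quota := (quota G rho L).
Local Notation invar := (invar G k q rho L).
Implicit Types S : state n.

(** The flag [sh S == sl S] pays for an extension or a start, both of which lower it. Only a pop can
    raise it, hence the 2 per unexplored node: one unit for the pop and one for the flag. *)
Definition budget S :=
  sd S + \sum_(x | clu S x == 0) (quota x + 2) + (n - sv S) + (sh S == sl S).

Lemma budget_draw S y : 0 < sd S -> budget (draw S y) < budget S.
Proof.
by rewrite /budget /draw; case: S => v x d h l Q c T /=; case: ifP => _ /= d0; lia.
Qed.

Lemma budget_pop S : invar S -> sd S = 0 -> sh S < sl S ->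
  budget (pop G rho L S) < budget S.
Proof.
move=> I d0 lth.
have szh : sh S < size (sq S) by exact: leq_trans (inv_l I).
have cz : clu S (nth (sx S) (sq S) (sh S)) = 0.
  by apply: (inv_wait I); rewrite (drop_nth (sx S)) // mem_head.
case: S {I} d0 lth szh cz => v x d h l Q c T /= d0 lth szh.
rewrite /budget /=; set z := nth x Q h => cz.
rewrite [X in _ < _ + X + _ + _](bigD1 z) /= ?cz //.
rewrite (eq_bigl (fun i => (c i == 0) && (i != z))); last first.
  by move=> i; rewrite /set_clu; case: (i =P z) => [->|_]; rewrite ?andbT ?andbF.
move: (\sum_(_ | _) _) => s; case: (_.+1 == l); lia.
Qed.

Lemma budget_extend S : 0 < q -> sh S = sl S -> q * sl S < size (sq S) ->
  budget (extend S) < budget S.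
Proof.
case: S => v x d h l Q c T /= q0 -> H; rewrite /budget /= eqxx.
have -> : (l == size Q) = false by apply/eqP; nia.
by rewrite addn0 addn1.
Qed.

Lemma budget_start S (r : 'I_n) : invar S -> sh S = sl S -> r = sv S :> nat ->
  clu S r = 0 -> budget (start S r) < budget S.
Proof.
move=> I eh Er cr; have E0 := inv_idle I eh Er cr.
have l0 := inv_l I; rewrite E0 /= in l0; have {}l0 : sl S = 0 by lia.
have h0 : sh S = 0 by lia.
by case: S l0 h0 {I E0 eh Er cr} => v x d h l Q c T /= -> ->; rewrite /budget /= addn0 addn1.
Qed.

Lemma budget_advance S : sh S = sl S -> sv S < n -> budget (advance S) < budget S.
Proof.
by case: S => v x d h l Q c T /= ->; rewrite /budget /= !eqxx; lia.
Qed.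

End Budget.

(** * The program *)

Local Open Scope nat_scope.

Local Notation "e1 ~+ e2" := (Bin Add e1 e2) (at level 50, left associativity).
Local Notation "e1 ~* e2" := (Bin Mul e1 e2) (at level 40, left associativity).
Local Notation "c1 ;; c2" := (Seq c1 c2) (at level 60, right associativity).

(* Register 2 holds rho, 3 holds n, 6 and 7 hold q and L, and 8-13 hold the
   fields sv, sx, sd, sh, sl and size sq of a state; [clu y] is at address y,
   item i of [sq] at n + i and [tb c y] at (c + 1) n + y. *)
Definition tb_addr c1 e := c1 ~* Reg 3 ~+ e.

Definition draw_cmd :=
  RandNeighbor 14 (Reg 9) ;;
  If (Bin Eqb (Read (Reg 14)) (Cst 0) ~*
      Bin Eqb (Read (tb_addr (Reg 8 ~+ Cst 2) (Reg 14))) (Cst 0))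
    (Store (tb_addr (Reg 8 ~+ Cst 2) (Reg 14)) (Reg 9 ~+ Cst 1) ;;
     Store (Reg 3 ~+ Reg 13) (Reg 14) ;;
     Assign 13 (Reg 13 ~+ Cst 1))
    Skip ;;
  Assign 10 (Bin Defs.Sub (Reg 10) (Cst 1)).

Definition pop_cmd :=
  Assign 9 (Read (Reg 3 ~+ Reg 11)) ;;
  Assign 11 (Reg 11 ~+ Cst 1) ;;
  Store (Reg 9) (Reg 8 ~+ Cst 1) ;;
  Degree 15 (Reg 9) ;;
  Assign 10 ((Bin Div (Reg 15) (Reg 2) ~+ Bin Ltb (Cst 0) (Reg 15)) ~* Reg 7).

Definition start_cmd :=
  Store (tb_addr (Reg 8 ~+ Cst 2) (Reg 8)) (Reg 8 ~+ Cst 1) ;;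
  Store (Reg 3) (Reg 8) ;;
  Assign 12 (Cst 1) ;;
  Assign 13 (Cst 1).

Definition advance_cmd :=
  Assign 8 (Reg 8 ~+ Cst 1) ;;
  Assign 11 (Cst 0) ;;
  Assign 12 (Cst 0) ;;
  Assign 13 (Cst 0).

Definition grow_cmd :=
  While (Bin Ltb (Reg 8) (Reg 3))
    (If (Reg 10) draw_cmd
    (If (Bin Ltb (Reg 11) (Reg 12)) pop_cmd
    (If (Bin Ltb (Reg 6 ~* Reg 12) (Reg 13)) (Assign 12 (Reg 13))
    (If (Read (Reg 8)) advance_cmd start_cmd)))).

Definition query_cmd :=
  let entry e1 e2 :=
    Bin Defs.Sub (Cst 1) (Bin Ltb (Read e2) (Read e1)) ~*
    (Bin Eqb (Read (tb_addr (Read e1 ~+ Cst 1) e2)) (Cst 0) ~+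
     Bin Eqb (Read (tb_addr (Read e1 ~+ Cst 1) e2)) (e1 ~+ Cst 1)) in
  TestEdge 2 (Reg 0) (Reg 1) ;;
  Assign 0 (Reg 2 ~* Bin Ltb (Cst 0) (entry (Reg 0) (Reg 1) ~+ entry (Reg 1) (Reg 0))).

(** * Each iteration of the machine follows the abstract process *)

Section Simulation.
Variables (R : realType) (w n : nat) (G : graph n) (k q rho L : nat).
Local Notation invar := (invar G k q rho L).
Local Notation good := (@good R w n G).
Implicit Types (S : state n) (s : store) (X : set store).

Hypothesis bigw : (n + 4) * (n + L + 4) <= 2 ^ w.
Hypotheses (q_le : q <= n.+1) (qpos : 0 < q).

(** Cluster numbers start at 1, so the table begins at address 2 n, clear of the cluster array below
    n and of the queue between n and 2 n. *)
Record rep s S : Prop := Rep {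
  rep2 : regs s 2 = rho; rep3 : regs s 3 = n; rep6 : regs s 6 = q;
  rep7 : regs s 7 = L; rep8 : regs s 8 = sv S; rep9 : regs s 9 = sx S;
  rep10 : regs s 10 = sd S; rep11 : regs s 11 = sh S; rep12 : regs s 12 = sl S;
  rep13 : regs s 13 = size (sq S);
  rep_clu : forall y : 'I_n, Defs.mem s y = clu S y;
  rep_sq : forall i x0, i < size (sq S) -> Defs.mem s (n + i) = nth x0 (sq S) i;
  rep_tb : forall c (y : 'I_n), 0 < c <= n -> Defs.mem s (c.+1 * n + y) = tb S c y }.

Lemma tb_addr_inj c c' (y y' : 'I_n) :
  (c.+1 * n + y == c'.+1 * n + y') = (c == c') && (y == y').
Proof.
have ly := ltn_ord y; have ly' := ltn_ord y'.
apply/eqP/andP => [E|[/eqP -> /eqP ->] //].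
have Ec : c = c' by nia.
by split; [apply/eqP|apply/eqP/val_inj => /=; subst c'; lia].
Qed.

Lemma quota_lt x : quota G rho L x <= n.+1 * L.
Proof.
rewrite /quota leq_mul2r; apply/orP; right.
have H : deg G x <= n by exact: size_nbrs_le.
by have := leq_div (deg G x) rho; case: (0 < deg G x) => /=; lia.
Qed.

(** The 20 here and below is one generous bound on the steps of any iteration; [bigw] excludes
    overflow of addresses and quotas. *)
Lemma sim_pop S s t p K X : invar S -> sv S < n -> sd S = 0 -> sh S < sl S -> rep s S ->
  (forall s', rep s' (pop G rho L S) -> good t p (grow_cmd :: K, s') X) ->
  good (20 + t) p (grow_cmd :: K, s) X.
Proof.
move=> I ltv d0 lth [r2 r3 r6 r7 r8 r9 r10 r11 r12 r13 rc rq rt] H.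
have szQ := size_uniq_ord (inv_uniq I).
have ll := inv_l I.
have [z Ez] : exists z, z = nth (sx S) (sq S) (sh S) by eexists.
have cz : clu S z = 0.
  by rewrite Ez; apply: (inv_wait I); rewrite (drop_nth (sx S)) ?mem_head //; lia.
have ltz := ltn_ord z.
have Mz : Defs.mem s (n + sh S) = z by rewrite Ez; apply: rq; lia.
have hL : L <= (n + 4) * L by nia.
have qz := quota_lt z.
have degn : deg G z <= n by exact: size_nbrs_le.
have nw : n < 2 ^ w by nia.
rewrite !addSn add0n /grow_cmd; apply: (good_while (v := 1)).
  by rewrite /= r8 r3 ltv wrap_small //; nia.
apply: (good_if (v := 0)); first by rewrite /= r10 d0.
apply: (good_if (v := 1)); first by rewrite /= r11 r12 lth wrap_small //; nia.
rewrite /=; apply: good_seq; apply: (good_assign (v := z)).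
- by rewrite /= r3 r11 wrap_small ?Mz //; nia.
- by nia.
apply: good_seq; apply: (good_assign (v := (sh S).+1)).
- by rewrite /= /upd /= r11 !wrap_small; nia.
- by nia.
apply: good_seq; apply: (good_store (a := z) (v := (sv S).+1)).
- by rewrite /= /upd.
- by rewrite /= /upd /= r8 !wrap_small; nia.
- by nia.
apply: good_seq; apply: (good_degree (u := z)) => //.
apply: (good_assign (v := quota G rho L z)).
- have b1 (b : bool) : b < 2 ^ w by case: b; nia.
  have dq := leq_div (deg G z) rho.
  have dw : deg G z %/ rho + (0 < deg G z) < 2 ^ w by case: (0 < _); nia.
  rewrite /= /upd /= r2 r7 -/(deg G z) (wrap_small (v := 0)) ?(wrap_small (b1 _)); last by nia.
  rewrite (wrap_small (v := deg G z %/ rho)) ?(wrap_small dw) ?wrap_small //; last by nia.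
  by apply: leq_ltn_trans qz _; nia.
- by nia.
apply: (good_le (t := t) (p := p)) => //; last by lia.
apply: H; case: (S) Ez cz ltz Mz qz degn ltv d0 lth szQ ll rc rq rt r2 r3 r6 r7 r8 r9 r10 r11 r12 r13 {I}
  => v x d h l Q c T /= Ez cz ltz Mz qz degn ltv d0 lth szQ ll rc rq rt r2 r3 r6 r7 r8 r9 r10 r11 r12 r13.
rewrite -Ez; split=> //=.
- by move=> y; rewrite /upd /set_clu val_eqE; case: ifP.
- move=> i x0 lti; rewrite /upd; case: eqP => [E|_]; first by lia.
  exact: rq.
- move=> i y lti; rewrite /upd; case: eqP => [E|_]; first by nia.
  exact: rt.
Qed.

Lemma sim_extend S s t p K X : invar S -> sv S < n -> sd S = 0 -> sh S = sl S ->
  q * sl S < size (sq S) -> rep s S ->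
  (forall s', rep s' (extend S) -> good t p (grow_cmd :: K, s') X) ->
  good (20 + t) p (grow_cmd :: K, s) X.
Proof.
move=> I ltv d0 eh ltq [r2 r3 r6 r7 r8 r9 r10 r11 r12 r13 rc rq rt] H.
have szQ := size_uniq_ord (inv_uniq I).
have ll := inv_l I.
rewrite !addSn add0n /grow_cmd; apply: (good_while (v := 1)).
  by rewrite /= r8 r3 ltv wrap_small //; nia.
apply: (good_if (v := 0)); first by rewrite /= r10 d0.
apply: (good_if (v := 0)); first by rewrite /= r11 r12 eh ltnn wrap_small //; nia.
apply: (good_if (v := 1)).
  by rewrite /= r6 r12 r13 (wrap_small (v := q * sl S)); [rewrite ltq wrap_small //; nia|nia].
apply: (good_assign (v := size (sq S))) => //; first by nia.
apply: (good_le (t := t) (p := p)) => //; last by lia.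
by apply: H; case: (S) rc rq rt r2 r3 r6 r7 r8 r9 r10 r11 r12 r13 => *; split.
Qed.

Lemma sim_advance S s (r : 'I_n) t p K X : invar S -> sv S < n -> sd S = 0 -> sh S = sl S ->
  r = sv S :> nat -> size (sq S) <= q * sl S -> clu S r <> 0 -> rep s S ->
  (forall s', rep s' (advance S) -> good t p (grow_cmd :: K, s') X) ->
  good (20 + t) p (grow_cmd :: K, s) X.
Proof.
move=> I ltv d0 eh Er leq_ cr [r2 r3 r6 r7 r8 r9 r10 r11 r12 r13 rc rq rt] H.
have szQ := size_uniq_ord (inv_uniq I).
have ll := inv_l I.
rewrite !addSn add0n /grow_cmd; apply: (good_while (v := 1)).
  by rewrite /= r8 r3 ltv wrap_small //; nia.
apply: (good_if (v := 0)); first by rewrite /= r10 d0.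
apply: (good_if (v := 0)); first by rewrite /= r11 r12 eh ltnn wrap_small //; nia.
apply: (good_if (v := 0)).
  by rewrite /= r6 r12 r13 (wrap_small (v := q * sl S)); [rewrite ltnNge leq_ wrap_small //; nia|nia].
apply: (good_if (v := clu S r)); first by rewrite /= r8 -Er rc.
have -> : clu S r != 0 by apply/eqP.
apply: good_seq; apply: (good_assign (v := (sv S).+1)).
- by rewrite /= r8 !wrap_small; nia.
- by nia.
apply: good_seq; apply: (good_assign (v := 0)); [by rewrite /= wrap_small //; nia|by nia|].
apply: good_seq; apply: (good_assign (v := 0)); [by rewrite /= wrap_small //; nia|by nia|].
apply: (good_assign (v := 0)); [by rewrite /= wrap_small //; nia|by nia|].
apply: (good_le (t := t) (p := p)) => //; last by lia.
by apply: H; case: (S) rc rq rt r2 r3 r6 r7 r8 r9 r10 r11 r12 r13 => *; split.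
Qed.

Lemma sim_start S s (r : 'I_n) t p K X : invar S -> sv S < n -> sd S = 0 -> sh S = sl S ->
  r = sv S :> nat -> clu S r = 0 -> rep s S ->
  (forall s', rep s' (start S r) -> good t p (grow_cmd :: K, s') X) ->
  good (20 + t) p (grow_cmd :: K, s) X.
Proof.
move=> I ltv d0 eh Er cr [r2 r3 r6 r7 r8 r9 r10 r11 r12 r13 rc rq rt] H.
have E0 := inv_idle I eh Er cr.
have l0 : sl S = 0 by have := inv_l I; rewrite E0 /=; lia.
rewrite !addSn add0n /grow_cmd; apply: (good_while (v := 1)).
  by rewrite /= r8 r3 ltv wrap_small //; nia.
apply: (good_if (v := 0)); first by rewrite /= r10 d0.
apply: (good_if (v := 0)); first by rewrite /= r11 r12 eh ltnn wrap_small //; nia.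
apply: (good_if (v := 0)).
  by rewrite /= r6 r12 r13 l0 E0 muln0 !wrap_small //; nia.
apply: (good_if (v := 0)); first by rewrite /= r8 -Er rc.
have a1 : ((sv S).+2 * n + sv S < 2 ^ w) by nia.
apply: good_seq; apply: (good_store (a := (sv S).+2 * n + r) (v := (sv S).+1)).
- by rewrite /= r3 r8 Er !wrap_small ?addn2 //; nia.
- by rewrite /= r8 !wrap_small; nia.
- by nia.
apply: good_seq; apply: (good_store (a := n) (v := r)).
- by rewrite /=.
- by rewrite /= r8 Er.
- by nia.
apply: good_seq; apply: (good_assign (v := 1)); [by rewrite /= wrap_small //; nia|by nia|].
apply: (good_assign (v := 1)); [by rewrite /= wrap_small //; nia|by nia|].
apply: (good_le (t := t) (p := p)) => //; last by lia.
apply: H; case: (S) ltv Er d0 a1 E0 rc rq rt r2 r3 r6 r7 r8 r9 r10 r11 r12 r13 {I cr eh l0}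
  => v x d h l Q c T /= ltv Er d0 a1 E0 rc rq rt r2 r3 r6 r7 r8 r9 r10 r11 r12 r13.
split=> //=.
- move=> y; rewrite /upd; have ly := ltn_ord y; case: eqP => [E|_]; first by lia.
  by case: eqP => [E|_]; [nia|exact: rc].
- by case=> // x0 _; rewrite addn0 /upd eqxx.
- move=> i y lti; rewrite /upd; case: eqP => [E|_]; first by nia.
  by rewrite tb_addr_inj /set_tb; case: ifP => // _; exact: rt.
Qed.

Lemma sim_draw S s t (f : 'I_n -> R) p K X : invar S -> sv S < n -> 0 < sd S -> rep s S ->
  (forall y s', y \in nbrs G (sx S) -> rep s' (draw S y) ->
     good t (f y) (grow_cmd :: K, s') X) ->
  (\sum_(y <- nbrs G (sx S)) f y <= p * (deg G (sx S))%:R)%R ->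
  good (20 + t) p (grow_cmd :: K, s) X.
Proof.
move=> I ltv d0 [r2 r3 r6 r7 r8 r9 r10 r11 r12 r13 rc rq rt] H Hp.
have hL : L <= (n + 4) * L by nia.
have quota_x := leq_trans (inv_quota I) (quota_lt (sx S)).
have D0 : 0 < deg G (sx S).
  have := leq_trans d0 (inv_quota I); rewrite /quota; case: (deg _ _) => //.
  by rewrite div0n.
have nw : n < 2 ^ w by nia.
have ltx := ltn_ord (sx S).
rewrite !addSn add0n /grow_cmd; apply: (good_while (v := 1)).
  by rewrite /= r8 r3 ltv wrap_small //; nia.
apply: (good_if (v := sd S)); first by rewrite /= r10.
rewrite -lt0n d0 /=; apply: good_seq.
apply: (good_rand_neighbor (u := sx S) (f := f)) => // y ynb.
have {H Hp} H s' := H y s' ynb.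
have Iy := inv_draw I d0 ynb.
have ly := ltn_ord y.
have a1 : ((sv S).+2 * n + y < 2 ^ w) by nia.
have Ty : Defs.mem s ((sv S).+2 * n + y) = tb S (sv S).+1 y by apply: rt; lia.
have cond : (clu S y == 0) * (tb S (sv S).+1 y == 0) = fresh S y.
  by rewrite mulnb.
have szQ := size_uniq_ord (inv_uniq Iy).
apply: good_seq; apply: (good_if (v := fresh S y)).
  rewrite /= /upd /= r3 r8 (wrap_small (v := sv S + _)); last by rewrite !wrap_small; nia.
  rewrite (wrap_small (v := 2)); last by nia.
  rewrite addn2 (wrap_small (v := _ * n)); last by nia.
  rewrite (wrap_small (v := _ + y)) // rc Ty (wrap_small (v := 0)); last by nia.
  have b1 (b : bool) : b < 2 ^ w by case: b; nia.
  by rewrite !(wrap_small (b1 _)) cond (wrap_small (b1 _)).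
case Ef : (fresh S y) => /=; last first.
  apply: good_skip; apply: (good_assign (v := (sd S).-1)).
  - by rewrite /= /upd /= r10 !wrap_small ?subn1 //; nia.
  - by nia.
  apply: (good_le (t := t) (p := f y)) => //; last by lia.
  apply: H; case: (S) Ef ltv rc rq rt r2 r3 r6 r7 r8 r9 r10 r11 r12 r13
    => v x d h l Q c T /= Ef ltv rc rq rt r2 r3 r6 r7 r8 r9 r10 r11 r12 r13.
  by rewrite Ef; split.
have szQ' : size (sq S) < n.
  by move: szQ; case: (S) Ef => v x d h l Q c T /= ->; rewrite size_rcons.
apply: good_seq; apply: (good_store (a := (sv S).+2 * n + y) (v := (sx S).+1)).
- by rewrite /= /upd /= r3 r8 !wrap_small ?addn2 //; nia.
- by rewrite /= /upd /= r9 !wrap_small; nia.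
- by nia.
apply: good_seq; apply: (good_store (a := n + size (sq S)) (v := y)).
- by rewrite /= /upd /= r3 r13 !wrap_small //; nia.
- by rewrite /= /upd.
- by nia.
apply: (good_assign (v := (size (sq S)).+1)).
- by rewrite /= /upd /= r13 !wrap_small; nia.
- by nia.
apply: (good_assign (v := (sd S).-1)).
- by rewrite /= /upd /= r10 !wrap_small ?subn1 //; nia.
- by nia.
apply: (good_le (t := t) (p := f y)) => //; last by lia.
apply: H; case: (S) Ef ltv szQ' rc rq rt r2 r3 r6 r7 r8 r9 r10 r11 r12 r13
  => v x d h l Q c T /= Ef ltv szQ' rc rq rt r2 r3 r6 r7 r8 r9 r10 r11 r12 r13.
rewrite Ef; split=> //=.
- by rewrite size_rcons.
- move=> y'; rewrite /upd; have ly' := ltn_ord y'; case: eqP => [E|_]; first by lia.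
  by case: eqP => [E|_]; [nia|exact: rc].
- move=> i x0; rewrite size_rcons ltnS => lti; rewrite nth_rcons /upd eqn_add2l.
  case: (ltngtP i (size Q)) lti => // lti _; case: eqP => [E|_]; first by nia.
  exact: rq.
- move=> i y' lti; rewrite /upd; case: eqP => [E|_]; first by nia.
  by rewrite tb_addr_inj /set_tb; case: ifP => // _; exact: rt.
Qed.

End Simulation.

(** The potential bounds the failure probability because it never rises in expectation, and the
    budget falls in every iteration. The extra 1 is the loop test that ends the run. *)
Lemma grow_good (R : realType) (w n : nat) (G : graph n) (k q rho m : nat) N S s (X : set store) :
  (n + 4) * (n + 2 * m + 4) <= 2 ^ w -> 0 < m -> 0 < rho ->
  0 < q <= n.+1 -> 0 < k -> n <= q ^ k ->
  (forall S s, invar G k q rho (2 * m) S -> sv S = n -> rep q rho (2 * m) s S ->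
     X s \/ (1 <= pot R G rho m S)%R) ->
  invar G k q rho (2 * m) S -> rep q rho (2 * m) s S ->
  budget G rho (2 * m) S <= N ->
  good w G (20 * N + 1) (pot R G rho m S) ([:: grow_cmd], s) X.
Proof.
move=> bigw m0 rho0 /andP[q0 qn] k0 qk final.
elim: N S s => [|N IH] S s I rs bud; have := inv_v I; rewrite leq_eqVlt => /orP[/eqP vn|ltv].
1,3: apply: (good_le (t := 1) (p := pot R G rho m S)); [|by lia|exact: lexx].
1,2: apply: (good_while (v := 0)); first by rewrite /= (rep8 rs) (rep3 rs) vn ltnn wrap_small ?expn_gt0.
1,2: apply: good_halt; [by apply: sumr_ge0 => x _; exact: node_pot_ge0|exact: final I vn rs].
  by move: bud; rewrite /budget; lia.
have -> : 20 * N.+1 + 1 = 20 + (20 * N + 1) by lia.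
case: (posnP (sd S)) => [d0|d0]; last first.
  apply: (sim_draw (f := fun y => pot R G rho m (draw S y)) bigw qn q0 I ltv d0 rs); last first.
    exact: pot_draw I d0.
  move=> y s' ynb rs'; apply: IH => //; first exact: inv_draw I d0 ynb.
  by have := budget_draw G rho (2 * m) y d0; lia.
have := inv_h I; rewrite leq_eqVlt => /orP[/eqP eh|lth]; last first.
  apply: (sim_pop bigw qn q0 I ltv d0 lth rs) => s' rs'.
  apply: (good_le _ (leqnn _) (pot_pop R rho0 m0 I d0 lth)).
  apply: IH => //; first exact: inv_pop.
  by have := budget_pop I d0 lth; lia.
case: (ltnP (q * sl S) (size (sq S))) => [ltq|leq_].
  apply: (sim_extend bigw qn q0 I ltv d0 eh ltq rs) => s' rs'.
  rewrite -pot_extend; apply: IH => //; first exact: inv_extend.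
  by have := budget_extend G rho (2 * m) q0 eh ltq; lia.
have Er : Ordinal ltv = sv S :> nat by [].
case: (clu S (Ordinal ltv) =P 0) => cr.
  apply: (sim_start bigw qn q0 I ltv d0 eh Er cr rs) => s' rs'.
  rewrite -(pot_start R I eh Er cr); apply: IH => //; first exact: inv_start.
  by have := budget_start I eh Er cr; lia.
apply: (sim_advance bigw qn q0 I ltv d0 eh Er leq_ cr rs) => s' rs'.
rewrite -pot_advance; apply: IH => //; first exact: (inv_advance I d0 eh Er).
by have := budget_advance G rho (2 * m) eh ltv; lia.
Qed.

(** * Computing the parameters L and q *)

Definition log_cmd :=
  While (Bin Ltb (Reg 4) (Reg 3 ~+ Cst 1))
    (Assign 4 (Reg 4 ~* Cst 2) ;; Assign 7 (Reg 7 ~+ Cst 6)).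

(* Searches for the least q >= 2 with n <= q ^ k; register 4 holds q ^ j for the
   j in register 5, which avoids overflow. *)
Definition root_cmd :=
  While (Bin Ltb (Reg 4) (Reg 3))
    (If (Bin Ltb (Reg 5) (Reg 1))
       (Assign 4 (Reg 4 ~* Reg 6) ;; Assign 5 (Reg 5 ~+ Cst 1))
       (Assign 6 (Reg 6 ~+ Cst 1) ;; Assign 4 (Reg 6) ;; Assign 5 (Cst 1))).

Definition build_cmd :=
  Assign 3 (Reg 0) ;; Assign 4 (Cst 1) ;; log_cmd ;;
  Assign 6 (Cst 2) ;; Assign 4 (Cst 2) ;; Assign 5 (Cst 1) ;; root_cmd ;;
  grow_cmd.

Section Setup.
Variables (R : realType) (w n : nat) (G : graph n) (k rho : nat).
Hypotheses (n0 : 0 < n) (bigw : (n + 4) * (n + 2 * (3 * bitlen n) + 4) <= 2 ^ w).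
Hypotheses (k0 : 0 < k < 2 ^ w).
Implicit Types (s : store) (X : set store).

Definition setup s := [/\ regs s 1 = k, regs s 2 = rho, regs s 3 = n,
  forall i, 7 < i -> regs s i = 0 & forall a, Defs.mem s a = 0].

Lemma pow_le_bitlen i : (2 ^ i <= n) = (i < bitlen n).
Proof.
apply/idP/idP => [H|H]; first by rewrite ltnS trunc_log_max.
apply: leq_trans (trunc_logP (ltnSn 1) n0); rewrite leq_exp2l //.
Qed.

(** The loop makes one round per power of 2 up to n, that is [bitlen n] rounds, and each adds 6 to
    register 7. So L = 2 m with m = 3 [bitlen n]. *)
Lemma log_good i s t p K X : i <= bitlen n -> setup s ->
  regs s 4 = 2 ^ i -> regs s 7 = 6 * i ->
  (forall s', setup s' -> regs s' 7 = 2 * (3 * bitlen n) -> good w G t p (K, s') X) ->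
  @good R w n G (4 * (bitlen n - i) + 1 + t) p (log_cmd :: K, s) X.
Proof.
move=> lei bs r4 r7 H; move Em : (bitlen n - i) => M.
elim: M i s lei bs r4 r7 Em => [|M IH] i s lei bs r4 r7 Em.
  have ei : i = bitlen n by lia.
  have lt4 : (2 ^ i < n.+1) = false by rewrite ltnS pow_le_bitlen ei ltnn.
  rewrite muln0 add0n add1n; apply: (good_while (v := 0)).
    have [_ _ r3 _ _] := bs.
    rewrite /= r4 r3 (wrap_small (v := 1)) ?addn1; last by nia.
    by rewrite (wrap_small (v := n.+1)) ?lt4 ?wrap_small //; nia.
  by apply: H => //; rewrite r7 ei; lia.
have lti : i < bitlen n by lia.
have le4 : 2 ^ i <= n by rewrite pow_le_bitlen.
have [r1 r2 r3 rr rm] := bs.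
have -> : 4 * M.+1 + 1 + t = (4 * M + 1 + t).+4 by lia.
apply: (good_while (v := 1)).
  rewrite /= r4 r3 (wrap_small (v := 1)) ?addn1; last by nia.
  by rewrite (wrap_small (v := n.+1)) ?ltnS ?le4 ?wrap_small //; nia.
rewrite /=; apply: good_seq; apply: (good_assign (v := 2 ^ i.+1)).
- by rewrite /= r4 (wrap_small (v := 2)) ?expnSr ?wrap_small //; nia.
- by rewrite expnSr; nia.
apply: (good_assign (v := 6 * i.+1)).
- by rewrite /= /upd /= r7 (wrap_small (v := 6)) ?wrap_small //; nia.
- by nia.
by apply: (IH i.+1) => //; [split=> // j jlt; rewrite /= /upd; case: eqP => [|_]; [lia|]; case: eqP => [|_]; [lia|]; exact: rr|lia].
Qed.

(** The candidates stay at most n, and each takes at most [bitlen n] rounds because 2 ^ j <= q ^ j <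
    n while the loop runs. The last alternative records minimality of q, from which the size bound
    follows. *)
Lemma root_good q j s t p K X : setup s -> regs s 7 = 2 * (3 * bitlen n) ->
  regs s 4 = q ^ j -> regs s 5 = j -> regs s 6 = q ->
  0 < j <= k -> 1 < q -> q = 2 \/ q.-1 ^ k < n ->
  (forall s' q', setup s' -> regs s' 7 = 2 * (3 * bitlen n) -> regs s' 6 = q' ->
     n <= q' ^ k -> 1 < q' -> q' = 2 \/ q'.-1 ^ k < n -> good w G t p (K, s') X) ->
  @good R w n G (8 * ((n.+1 - q) * bitlen n + (bitlen n - j)) + 1 + t) p (root_cmd :: K, s) X.
Proof.
move=> bs r7 r4 r5 r6 jk q1 qH H.
have [N leN] : exists N, (n.+1 - q) * bitlen n + (bitlen n - j) <= N by eexists.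
elim: N q j s leN bs r7 r4 r5 r6 jk q1 qH => [|N IH] q j s leN bs r7 r4 r5 r6 /andP[j0 jk] q1 qH;
  case: (leqP n (q ^ j)) => [len|ltn_].
1,3: apply: (good_le (t := t.+1) (p := p)); [|by rewrite -add1n leq_add2r leq_addl|exact: lexx].
1,2: have [_ _ r3 _ _] := bs.
1,2: apply: (good_while (v := 0));
    first by rewrite /= r4 r3 ltnNge len wrap_small //; nia.
1,2: by apply: (H _ q) => //; apply: leq_trans len _; rewrite leq_exp2l.
all: have qn : q < n by apply: leq_ltn_trans ltn_; rewrite -{1}(expn1 q) leq_exp2l.
all: have jb : j < bitlen n by rewrite -pow_le_bitlen; apply: leq_trans (ltnW ltn_); rewrite leq_exp2r.
  by nia.
have [r1 r2 r3 rr rm] := bs.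
have step_ M : 8 * M.+1 + 1 + t = (8 * M + 1 + t).+4.+4 by lia.
have [M EM] : exists M, (n.+1 - q) * bitlen n + (bitlen n - j) = M.+1.
  exists ((n.+1 - q) * bitlen n + (bitlen n - j)).-1.
  by rewrite prednK // addn_gt0 subn_gt0 jb orbT.
rewrite EM step_; apply: (good_while (v := 1)).
  by rewrite /= r4 r3 ltn_ wrap_small //; nia.
case: (ltnP j k) => [ltk|lek].
  apply: (good_if (v := 1)); first by rewrite /= r5 r1 ltk wrap_small //; nia.
  rewrite /=; apply: good_seq; apply: (good_assign (v := q ^ j.+1)).
  - by rewrite /= r4 r6 expnSr wrap_small //; nia.
  - by rewrite expnSr; nia.
  apply: (good_assign (v := j.+1)).
  - by rewrite /= /upd /= r5 (wrap_small (v := 1)) ?addn1 ?wrap_small //; nia.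
  - by nia.
  apply: (good_le (t := 8 * ((n.+1 - q) * bitlen n + (bitlen n - j.+1)) + 1 + t) (p := p)) => //; last by lia.
  apply: IH => //.
  - by lia.
  - by split=> // i lti; rewrite /= /upd; case: eqP => [|_]; [lia|]; case: eqP => [|_]; [lia|]; exact: rr.
apply: (good_if (v := 0)); first by rewrite /= r5 r1 ltnNge lek wrap_small //; nia.
have ejk : j = k by lia.
rewrite /=; apply: good_seq; apply: (good_assign (v := q.+1)).
- by rewrite /= r6 (wrap_small (v := 1)) ?addn1 ?wrap_small //; nia.
- by nia.
apply: good_seq; apply: (good_assign (v := q.+1)) => //; first by nia.
apply: (good_assign (v := 1)); [by rewrite /= wrap_small //; nia|by nia|].
(* Resetting j to 1 costs less than the [bitlen n] gained by raising q. *)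
apply: (good_le (t := 8 * ((n.+1 - q.+1) * bitlen n + (bitlen n - 1)) + 1 + t) (p := p)) => //; last first.
  have : (n.+1 - q.+1) * bitlen n + (bitlen n - 1) <= M by nia.
  by lia.
apply: IH => //; first by nia.
- by split=> // i lti; rewrite /= /upd; case: eqP => [|_]; [lia|]; case: eqP => [|_]; [lia|]; case: eqP => [|_]; [lia|]; exact: rr.
- by case/andP: k0.
- by lia.
- by right; rewrite /= -ejk.
Qed.

End Setup.

(** * The spanner *)

(** Replacing each edge of a walk by its detour stretches the walk by at most a, and this passes to
    the infimum over walks, also when there are none. *)
Lemma is_spanner_edges (R : realType) (T : finType) a (e h : rel T) :
  0 < a -> symmetric h -> subrel h e ->
  (forall x y, e x y -> exists p, [/\ path h x p, last x p = y & size p <= a]) ->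
  is_spanner R a e h.
Proof.
move=> a0 hs he H; split=> // s t.
have W p : forall x, path e x p ->
    exists p', [/\ path h x p', last x p' = last x p & size p' <= a * size p].
  elim: p => [|y p IH] x /=; first by exists [::]; split=> //; rewrite muln0.
  case/andP => /H [p1 [P1 L1 S1]] /IH [p2 [P2 L2 S2]]; exists (p1 ++ p2).
  by rewrite cat_path last_cat size_cat P1 L1 P2 L2; split=> //; lia.
rewrite -lee_pdivrMl ?ltr0n //; apply: le_ereal_inf_tmp => _ [p [Pp Lp] <-].
rewrite lee_pdivrMl ?ltr0n //; have [p' [P' L' S']] := W p s Pp.
apply: (@le_trans _ _ ((size p')%:R)%:E).
  by apply: ereal_inf_lbound; exists p' => //; split=> //; rewrite L'.
by rewrite -EFinM lee_fin -natrM ler_nat.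
Qed.

(** Double counting: the neighbours of u inject into the edges at u, and an edge has at most two
    endpoints. *)
Lemma sum_deg_le n (G : graph n) : \sum_u deg G u <= 2 * #|edges (adj G)|.
Proof.
have degE u : deg G u <= \sum_(e in edges (adj G)) (u \in e).
  rewrite -big_mkcondr /= sum1_card /deg -(card_uniqP (nbrs_uniq G u)).
  rewrite -(@card_in_imset _ _ (fun v => [set u; v]%SET)).
    apply/subset_leq_card/fintype.subsetP => _ /imsetP[v nv ->].
    rewrite unfold_in /= !finset.inE eqxx andbT; apply/imsetP; exists (u, v) => //.
    by rewrite finset.inE /= -mem_nbrs.
  move=> v v'; rewrite !mem_nbrs => av av' /setP/(_ v); rewrite !finset.inE eqxx orbT.
  by case: (v =P u) => [E|_ /esym/eqP //]; rewrite E adj_irr in av.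
apply: (@leq_trans (\sum_u \sum_(e in edges (adj G)) (u \in e))).
  by apply: leq_sum => u _; exact: degE.
rewrite exchange_big /= mulnC -sum_nat_const; apply: leq_sum => e /imsetP[p _ ->].
rewrite -big_mkcond /= sum1_card cards2; by case: (_ != _).
Qed.

(** * Stretch, size and queries of the spanner at the end of the process *)

Section Outcome.
Variables (n : nat) (G : graph n) (k q rho L : nat) (S : state n).
Hypotheses (I : invar G k q rho L S) (vn : sv S = n).

Definition kept (x y : 'I_n) :=
  (clu S x <= clu S y) && ((tb S (clu S x) y == 0) || (tb S (clu S x) y == x.+1)).

Definition spanner_rel : rel 'I_n := fun x y => adj G x y && (kept x y || kept y x).

Lemma end_sq : sq S = [::].
Proof.
case: (inv_root I) => // -[r [? [E _ _]]].
by have := ltn_ord r; rewrite -E vn ltnn.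
Qed.

Lemma end_clu y : 0 < clu S y <= n.
Proof.
have H1 : clu S y <> 0 by apply: (inv_past I); rewrite vn.
have := inv_cur I y; rewrite end_sq in_nil vn => H2.
by have := inv_clu I y; rewrite vn leq_eqVlt H2 /=; lia.
Qed.

Lemma end_sd : sd S = 0.
Proof.
case: (posnP (sd S)) => // d0; have := inv_x I d0; have := end_clu (sx S).
by rewrite vn; lia.
Qed.

Lemma spanner_rel_sym : symmetric spanner_rel.
Proof. by move=> x y; rewrite /spanner_rel adj_sym orbC. Qed.

Lemma parent_edge c (x y : 'I_n) : tb S c y = x.+1 -> clu S x = c -> adj G x y ->
  c <= clu S y -> spanner_rel y x.
Proof.
move=> E1 E2 a le; rewrite spanner_rel_sym /spanner_rel a /= /kept E2 le E1 eqxx.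
by rewrite !orbT.
Qed.

Lemma descends_path c j y : descends G (clu S) (tb S) c j y -> c <= clu S y ->
  exists p, [/\ path spanner_rel y p, (last y p).+1 = c & size p <= j].
Proof.
elim: j y => [|j IH] y /=; first by move=> E _; exists [::].
move=> [H|[x [E1 E2 a H]]] le.
  by have [p [? ? ?]] := IH y H le; exists p; split=> //; exact: leqW.
have [|p [P1 P2 P3]] := IH x H; first by rewrite E2.
by exists (x :: p); split=> //=; rewrite (parent_edge E1 E2 a le).
Qed.

Lemma member_path y : exists p,
  [/\ path spanner_rel y p, (last y p).+1 = clu S y & size p <= k.-1].
Proof.
have cy : clu S y <> 0 by have := end_clu y; lia.
by have [_ H] := inv_member I cy; exact: descends_path H (leqnn _).
Qed.

Lemma boundary_path c y : 0 < k -> tb S c y <> 0 -> c <= clu S y -> exists p,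
  [/\ path spanner_rel y p, (last y p).+1 = c & size p <= k].
Proof.
move=> k0 Ty le; have [_ [E|[x [E1 E2 a]]]] := inv_parent I Ty; first by exists [::].
have [p [P1 P2 P3]] := member_path x; exists (x :: p).
by split=> //=; rewrite ?(parent_edge E1 E2 a le) ?P2 //; lia.
Qed.

(** If nobody discovered y for the cluster of x, the edge itself is kept. Otherwise y reaches the
    root of that cluster in k steps, and x reaches it in k - 1. *)
Lemma adj_path_le x y : 0 < k -> adj G x y -> clu S x <= clu S y -> exists p,
  [/\ path spanner_rel y p, last y p = x & size p <= 2 * k - 1].
Proof.
move=> k0 a le; case: (tb S (clu S x) y =P 0) => Ty.
  exists [:: x]; split=> //=; last by lia.
  by rewrite spanner_rel_sym /spanner_rel a /kept le Ty.
have [p [P1 P2 P3]] : exists p, [/\ path spanner_rel y p,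
    (last y p).+1 = clu S x & size p <= k] by exact: boundary_path.
have [p' [P1' P2' P3']] := member_path x.
(* The path from x to the root is walked backwards; the two paths end at the same node, as both ends
   have successor [clu S x]. *)
exists (p ++ rev (belast x p')); rewrite cat_path last_cat size_cat size_rev size_belast.
have -> : last y p = last x p' by apply: val_inj => /=; lia.
rewrite P1 rev_path (eq_path (e' := spanner_rel)) ?P1'; last first.
  by move=> u v /=; rewrite spanner_rel_sym.
split=> //; last by lia.
by case: (p') => //= z l; rewrite rev_cons last_rcons.
Qed.

Lemma spanner_rel_spanner (R : realType) a : 0 < k -> 2 * k - 1 <= a -> is_spanner R a (adj G) spanner_rel.
Proof.
move=> k0 lea; apply: is_spanner_edges; first by lia.
- exact: spanner_rel_sym.
- by move=> x y /andP[].
move=> x y axy; case: (leqP (clu S y) (clu S x)) => [le|/ltnW le].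
  have [p [? ? ?]] := adj_path_le k0 (etrans (adj_sym G y x) axy) le.
  by exists p; split=> //; exact: leq_trans lea.
have [p [P1 P2 P3]] := adj_path_le k0 axy le.
exists (rev (belast y p)); rewrite -{1 2}P2 rev_path size_rev size_belast.
split; last exact: leq_trans lea.
  by rewrite (eq_path (e' := spanner_rel)) // => u v /=; rewrite spanner_rel_sym.
by case: (p) => //= z l; rewrite rev_cons last_rcons.
Qed.

(** A table entry names a single discoverer, so it is a hit of at most one node. *)
Lemma sum_hits_le : \sum_x hits S x <= discoveries S.
Proof.
rewrite /hits /discoveries exchange_big /= [X in _ <= X]exchange_big /=.
apply: leq_sum => y _.
apply: (@leq_trans (\sum_(x : 'I_n) \sum_(c < n.+1) (tb S c y == x.+1))).
  apply: leq_sum => x _; have /andP[_ lec] := end_clu x.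
  have ltc : clu S x < n.+1 by [].
  by rewrite (bigD1 (Ordinal ltc)) //= leq_addr.
rewrite exchange_big /=; apply: leq_sum => c _.
case: (tb S c y) => [|b]; first by rewrite big1.
case: (ltnP b n) => [ltb|leb].
  rewrite (bigD1 (Ordinal ltb)) //= big1 ?eqxx // => x ne.
  by rewrite eqSS eq_sym; case: eqP => // E; case/eqP: ne; exact: val_inj.
by rewrite big1 // => x _; have := ltn_ord x; rewrite eqSS; case: (b =P x) => //; lia.
Qed.

(** A kept edge that is no hit leads to an undiscovered y. Such a y is outside the cluster of x,
    whose members are all discovered, so its cluster is strictly younger and the edge is a miss. *)
Lemma kept_le x : \sum_y (adj G x y && kept x y) <= hits S x + misses G S x.
Proof.
rewrite /misses [X in _ <= _ + X]big_uniq ?nbrs_uniq //= [X in _ <= _ + X]big_mkcond /= /hits -big_split /=.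
apply: leq_sum => y _; rewrite mem_nbrs /kept.
case: (adj G x y) => //=; case: (leqP (clu S x) (clu S y)) => //= le.
case: (_ == x.+1) => //=; first by rewrite orbT.
rewrite orbF add0n; case: (tb S (clu S x) y =P 0) => //= Ty; rewrite andbT.
have cy : clu S y <> 0 by have := end_clu y; lia.
have [Tm _] := inv_member I cy; rewrite [clu S x < _]ltn_neqAle le andbT.
by case: (clu S x =P clu S y) => [E|]; [rewrite E in Ty|rewrite orbT].
Qed.

(** With at most q n hits in all, the sum of h + (h + 1) rho over the nodes is at most q n (rho + 1)
    + n rho. *)
Lemma card_spanner : 0 < q -> 0 < rho ->
  (forall x, misses G S x < (hits S x).+1 * rho) ->
  #|edges spanner_rel| <= 3 * q * rho * n.
Proof.
move=> q0 rho0 H.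
apply: (@leq_trans #|[pred p : 'I_n * 'I_n | adj G p.1 p.2 && kept p.1 p.2]|).
  apply: leq_trans (leq_imset_card (fun p : 'I_n * 'I_n => [set p.1; p.2]%SET) _).
  apply/subset_leq_card/fintype.subsetP => _ /imsetP[[x y] /= /andP[a Hk] ->].
  case/orP: Hk => Hk; first by apply/imsetP; exists (x, y) => //; rewrite finset.inE /= a.
  by rewrite finset.setUC; apply/imsetP; exists (y, x) => //; rewrite finset.inE /= adj_sym a.
rewrite -sum1_card big_mkcond /= -(pair_big predT predT (fun x y => if adj G x y && kept x y then 1 else 0)) /=.
apply: (@leq_trans (\sum_x (hits S x + (hits S x).+1 * rho))).
  apply: leq_sum => x _; apply: leq_trans (leq_trans (kept_le x) _).
    by apply: leq_sum => y _; case: (_ && _).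
  by rewrite leq_add2l ltnW.
have E : \sum_x (hits S x + (hits S x).+1 * rho) = (\sum_x hits S x) * rho.+1 + n * rho.
  rewrite big_distrl /= -[X in _ = _ + X * rho]card_ord -sum1_card big_distrl -big_split /=.
  by apply: eq_bigr => x _; lia.
have cnt := inv_count I; rewrite end_sq /= addn0 in cnt.
have ex : explored S <= n.
  rewrite /explored -[X in _ <= X]card_ord -sum1_card; apply: leq_sum => y _; by case: (_ != _).
have hq : \sum_x hits S x <= q * n.
  by apply: leq_trans sum_hits_le _; move: cnt; nia.
by rewrite E; nia.
Qed.

Lemma query_oracle w s t : (n + 4) * (n + L + 4) <= 2 ^ w ->
  rep q rho L s S -> 3 <= t -> is_adjacency_oracle w G t query_cmd s spanner_rel.
Proof.
move=> bigw rs t3; split=> // u v.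
have [t' ->] : exists t', t = t'.+3 by exists (t - 3); lia.
have b1 (b : bool) : b < 2 ^ w by case: b; nia.
have lu := ltn_ord u; have lv := ltn_ord v.
have cu := end_clu u; have cv := end_clu v.
have nw : n < 2 ^ w by nia.
have entry x y :
    Defs.wrap w (Defs.wrap w (Defs.wrap w 1 - Defs.wrap w (clu S y < clu S x)) *
      Defs.wrap w (Defs.wrap w (tb S (clu S x) y == Defs.wrap w 0) +
        Defs.wrap w (tb S (clu S x) y == Defs.wrap w (x + Defs.wrap w 1)))) = kept x y.
  have lx := ltn_ord x.
  have w0 : Defs.wrap w 0 = 0 by rewrite wrap_small; nia.
  have w1 : Defs.wrap w 1 = 1 by rewrite wrap_small; nia.
  rewrite w0 w1 addn1 (wrap_small (v := x.+1)) ?(wrap_small (b1 _)); last by nia.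
  rewrite /kept [clu S x <= _]leqNgt; case: (clu S y < clu S x); rewrite /= ?subnn ?subn0 ?w0 ?w1 ?mul0n ?mul1n //.
  case: (tb S (clu S x) y =P 0) => [->|_] /=; first by rewrite addn0 !w1.
  by rewrite add0n !(wrap_small (b1 _)).
have addr (x y : 'I_n) :
    Defs.mem s (Defs.wrap w (Defs.wrap w (Defs.wrap w (clu S x + Defs.wrap w 1) * n) + y)) =
    tb S (clu S x) y.
  have lx := ltn_ord x; have ly := ltn_ord y; have cx := end_clu x.
  rewrite (wrap_small (v := 1)) ?(wrap_small (v := _ + 1)) ?(wrap_small (v := _ * n)) ?(wrap_small (v := _ + y)); try nia.
  by rewrite addn1 (rep_tb rs).
rewrite /query_cmd; do 3 (apply: always_det; [by []|by rewrite /step|]).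
have -> Y s' : always w G t' ([::], s') Y = Y s' by case: (t').
rewrite /= /query_input /set_reg /update /=.
have wu : Defs.wrap w u = u by rewrite wrap_small; nia.
have wv : Defs.wrap w v = v by rewrite wrap_small; nia.
rewrite wu wv (rep3 rs) !(rep_clu rs) !addr !entry edge_word_ord (wrap_small (v := 0)); last by nia.
rewrite (wrap_small (v := kept u v + _)); last by case: (kept u v); case: (kept v u); nia.
rewrite !(wrap_small (b1 _)) addn_gt0 !lt0b mulnb -/(spanner_rel u v).
by rewrite !(wrap_small (b1 _)).
Qed.

End Outcome.

(** * The whole construction, from the empty state *)

Definition init_state n (x : 'I_n) : state n :=
  State 0 x 0 0 0 [::] (fun=> 0) (fun _ _ => 0).

Lemma inv_init n (G : graph n) k q rho L (x : 'I_n) : invar G k q rho L (init_state x).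
Proof.
split=> //=; try by left.
rewrite /discoveries big1 ?add0n ?muln0 // => c _; exact: big1.
Qed.

(** Initially every node is unexplored, so the potential is n times [eps]. The placeholder current
    node has to be 0, the initial content of register 9. *)
Lemma build_good (R : realType) w n (G : graph n) (x0 : 'I_n) k rho s (X : set store) :
  x0 = 0 :> nat ->
  (n + 4) * (n + 2 * (3 * bitlen n) + 4) <= 2 ^ w -> 0 < k < 2 ^ w -> 0 < rho ->
  (forall i, regs s i = nth 0 [:: n; k; rho] i) -> (forall a, Defs.mem s a = 0) ->
  (forall q S s, 1 < q -> q = 2 \/ q.-1 ^ k < n ->
     invar G k q rho (2 * (3 * bitlen n)) S -> sv S = n ->
     rep q rho (2 * (3 * bitlen n)) s S ->
     X s \/ (1 <= pot R G rho (3 * bitlen n) S)%R) ->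
  good w G (20 * budget G rho (2 * (3 * bitlen n)) (init_state x0) +
            8 * (n * bitlen n + bitlen n) + 4 * bitlen n + 20)
    (n%:R * eps R n (3 * bitlen n))%R ([:: build_cmd], s) X.
Proof.
move=> x00 bigw kw rho0 Rs Ms final; set N := budget _ _ _ _.
have n0 : 0 < n by exact: leq_ltn_trans (leq0n x0) (ltn_ord x0).
have -> : (n%:R * eps R n (3 * bitlen n) = pot R G rho (3 * bitlen n) (init_state x0))%R.
  by rewrite /pot /node_pot /= sumr_const card_ord mulr_natl.
set p := pot _ _ _ _ _.
pose t2 := 8 * ((n.+1 - 2) * bitlen n + (bitlen n - 1)) + 1 + (20 * N + 1).
apply: (good_le (t := (4 * (bitlen n - 0) + 1 + t2.+4.+3).+4.+1) (p := p)); last exact: lexx; last first.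
  by rewrite /t2; nia.
rewrite /build_cmd.
apply: good_seq; apply: (good_assign (v := n)); [by rewrite /= Rs|by nia|].
apply: good_seq; apply: (good_assign (v := 1)); [by rewrite /= wrap_small //; nia|by nia|].
apply: good_seq; apply: (log_good (rho := rho) n0 bigw kw) => //.
- by split; rewrite /= /upd /= ?Rs // => i lti; case: eqP => [|_]; [lia|]; case: eqP => [|_]; [lia|];
    rewrite Rs nth_default //=; lia.
- by rewrite /= /upd /= Rs.
move=> {Rs Ms s} s [r1 r2 r3 rr rm] r7.
apply: good_seq; apply: (good_assign (v := 2)); [by rewrite /= wrap_small //; nia|by nia|].
apply: good_seq; apply: (good_assign (v := 2)); [by rewrite /= wrap_small //; nia|by nia|].
apply: good_seq; apply: (good_assign (v := 1)); [by rewrite /= wrap_small //; nia|by nia|].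
apply: good_seq; apply: (root_good (rho := rho) (q := 2) (j := 1) n0 bigw kw) => //.
- by split=> //= i lti; rewrite /upd /=; case: eqP => [|_]; [lia|]; case: eqP => [|_]; [lia|];
    case: eqP => [|_]; [lia|]; exact: rr.
- by case/andP: kw.
- by left.
move=> {r1 r2 r3 rr rm r7 s} s q [r1 r2 r3 rr rm] r7 r6 qk q1 qn.
apply: (grow_good (k := k) (q := q)) => //; try lia.
- case: qn => [->|H]; first by lia.
  have : q.-1 <= q.-1 ^ k by rewrite -{1}(expn1 q.-1) leq_pexp2l //; lia.
  by lia.
- by move=> S s' I' vn rs; apply: final I' vn rs.
- exact: inv_init.
- by split=> //= *; rewrite ?rr ?rm ?x00.
Qed.

(** * Numerical estimates and conclusion *)

Local Open Scope ring_scope.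

Lemma le_polylog B n : (0 < B)%N -> (B * bitlen n <= polylog B n)%N.
Proof. by move=> B0; rewrite leq_mul2l -{1}(expn1 (bitlen n)) leq_pexp2l // orbT. Qed.

Lemma root_le (R : realType) n k q : (0 < n)%N -> (0 < k)%N ->
  q = 2%N \/ (q.-1 ^ k < n)%N -> q%:R <= 2 * n%:R `^ k%:R^-1 :> R.
Proof.
move=> n0 k0 H.
have p1 : 1 <= n%:R `^ k%:R^-1 :> R.
  rewrite -{1}(powRr0 (n%:R : R)) ler_powR ?ler1n //.
case: H => [->|H]; first by rewrite ler_peMr ?ler0n.
have : q.-1%:R <= n%:R `^ k%:R^-1 :> R.
  have -> : q.-1%:R = (q.-1 ^ k)%:R `^ k%:R^-1 :> R.
    by rewrite natrX -powR_mulrn ?ler0n // -powRrM mulfV ?pnatr_eq0 -?lt0n // powRr1 ?ler0n.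
  by apply: ge0_ler_powR; rewrite ?nnegrE ?invr_ge0 ?ler0n // ler_nat ltnW.
have : q%:R <= q.-1%:R + 1 :> R by rewrite natr1 ler_nat; lia.
by lra.
Qed.

(** Rounding costs a factor 2, as rho < r + 1 <= 2 r, and the degree sum another 2. If rho was cut
    down to M > n, all quotients are 0. *)
Lemma sum_div_deg_le (R : realType) n (G : graph n) (rho : R) M r :
  1 <= rho -> (n < M)%N -> r = minn (Num.truncn rho) M ->
  (\sum_u deg G u %/ r)%:R <= 4 * #|edges (adj G)|%:R / rho.
Proof.
move=> rho1 nM Er.
have t1 : (0 < Num.truncn rho)%N by rewrite truncn_gt0.
have : (\sum_u deg G u %/ r)%:R <= (\sum_u deg G u)%:R * (2 / rho) :> R.
  rewrite !natr_sum mulr_suml; apply: ler_sum => u _.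
  have degn : (deg G u <= n)%N by exact: size_nbrs_le.
  case: (leqP (Num.truncn rho) M) => le.
    have Er' : r = Num.truncn rho by rewrite Er; lia.
    have r0 : 0 < r%:R :> R by rewrite ltr0n Er'.
    have : (deg G u %/ r)%:R * r%:R <= (deg G u)%:R :> R by rewrite -natrM ler_nat leq_trunc_div.
    have : rho < r%:R + 1 by rewrite natr1 Er' truncnS_gt.
    have : 1 <= r%:R :> R by rewrite ler1n Er'.
    rewrite mulrA ler_pdivlMr; last by lra.
    have : 0 <= (deg G u %/ r)%:R :> R by exact: ler0n.
    by nra.
  rewrite divn_small ?mulr_ge0 ?ler0n ?invr_ge0 //; [by lra|by rewrite Er; lia].
move=> /le_trans; apply.
have := sum_deg_le G; rewrite -(ler_nat R) natrM => H.
have -> : 4 * #|edges (adj G)|%:R / rho = (2 * #|edges (adj G)|%:R) * (2 / rho) by ring.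
by apply: ler_wpM2r => //; rewrite mulr_ge0 ?ler0n ?invr_ge0 //; lra.
Qed.

(** Both n and [bitlen n] are below M = 2 ^ [bitlen n], so the left side is at most 36 M ^ 2, and M
    ^ 6 >= 64 covers the 36. *)
Lemma word_bound n : (0 < n)%N ->
  ((n + 4) * (n + 2 * (3 * bitlen n) + 4) <= 2 ^ (8 * bitlen n))%N.
Proof.
move=> n0; have Hn : (n < 2 ^ bitlen n)%N by exact: trunc_log_ltn.
have Hb : (bitlen n < 2 ^ bitlen n)%N by exact: ltn_expl.
rewrite mulnC (mulnC 8) expnM; move: Hn Hb; set M := (2 ^ bitlen n)%N => Hn Hb.
have M2 : (2 <= M)%N by lia.
have M6 : (2 ^ 6 <= M ^ 6)%N by rewrite leq_exp2r.
apply: (@leq_trans (9 * M * (4 * M))); first by apply: leq_mul; lia.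
by rewrite (expnD M 6 2) -(mulnn M); nia.
Qed.

Lemma time_arith b n E Q : (0 < b)%N -> (0 < n)%N ->
  (Q <= (E + n) * (2 * (3 * b)) + n * 2 ->
   20 * (Q + n + 1) + 8 * (n * b + b) + 4 * b + 20 <= 240 * b * (n + E))%N.
Proof.
move=> b0 n0 H.
have nb : (n <= b * n)%N by rewrite leq_pmull.
have bn : (b <= b * n)%N by rewrite leq_pmulr.
have EH : ((E + n) * (2 * (3 * b)) = 6 * (b * E) + 6 * (b * n))%N by ring.
have -> : (240 * b * (n + E) = 240 * (b * E) + 240 * (b * n))%N by ring.
by move: H; rewrite EH [(n * b)%N]mulnC; lia.
Qed.

Theorem mainTheorem5 (R : realType) :
  exists (build query : cmd) (b : nat) (c : R), 0 < c /\
  forall A : nat, exists B : nat,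
  forall (n : nat) (G : graph n) (k : nat) (rho : R),
    (0 < n)%N -> (0 < k)%N -> (k <= polylog A n)%N -> 1 <= rho ->
    let w := (b * bitlen n)%N in
    let start : config := ([:: build], build_input w n k rho) in
    exists t : nat,
      [/\ t%:R <= (polylog B n)%:R * (n%:R + #|edges (adj G)|%:R / rho),
          always w G t start setT &
          1 - (n%:R `^ c)^-1 <=
          prob w G R t start
            [set s | exists h : rel 'I_n,
               [/\ is_adjacency_oracle w G (polylog B n) query s h,
                   is_spanner R (2 * k - 1) (adj G) h &
                   #|edges h|%:R <=
                   (polylog B n)%:R * n%:R `^ (1 + k%:R^-1) * rho ^+ 2]]].
Proof.
(* The word length factor 8 is that of [word_bound]; the exponent 1 comes from a failure probability
   of at most 1 / n. *)
exists build_cmd, query_cmd, 8%N, 1; split=> // A.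
have [B EB] : exists B, B = 1000%N by eexists.
exists B => n G k rho n0 k0 _ rho1 w start.
have bw := word_bound n0; rewrite -/w in bw.
have bl0 : (0 < bitlen n)%N by [].
have PB := le_polylog n (B := B); rewrite {1}EB in PB; have {}PB := PB isT.
set M := (2 ^ w).-1.
have nM : (n < M)%N by rewrite /M; nia.
have ltM : (M < 2 ^ w)%N by rewrite /M; nia.
pose k' := minn k M; pose r := minn (Num.truncn rho) M.
have tr0 : (0 < Num.truncn rho)%N by rewrite truncn_gt0.
have k'0 : (0 < k' < 2 ^ w)%N by rewrite /k'; lia.
have r0 : (0 < r)%N by rewrite /r; lia.
have r_le : r%:R <= rho.
  apply: (@le_trans _ _ (Num.truncn rho)%:R); first by rewrite ler_nat geq_minl.
  by rewrite truncn_le; lra.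
pose m := (3 * bitlen n)%N.
match goal with |- context [prob _ _ _ _ _ ?Y] => set X := Y end.
pose x0 : 'I_n := Ordinal n0.
pose T := (20 * budget G r (2 * m) (init_state x0) + 8 * (n * bitlen n + bitlen n) + 4 * bitlen n + 20)%N.
have [alw pr] : good w G T (n%:R * eps R n m) start X.
  apply: (@build_good R w n G x0 k' r) => //.
  - by move=> i; rewrite /= /saturate -/M (_ : minn n M = n) //; lia.
  - move=> q S s q1 qH I vn rs.
    have [bad|good_] := pselect (exists x, ((hits S x).+1 * r <= misses G S x)%N).
      right; case: bad => x bad; apply: pot_bad bad; first by lia.
        exact: end_sd I vn.
      by have := end_clu I vn x; lia.
    left; exists (spanner_rel G S); split.
    + by apply: (query_oracle I vn bw rs); lia.
    + by apply: (spanner_rel_spanner I vn); lia.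
    + have card : (#|edges (spanner_rel G S)| <= 3 * q * r * n)%N.
        apply: (card_spanner I vn); [by lia|by lia|move=> x; rewrite ltnNge; apply/negP => bad].
        by apply: good_; exists x.
      (* The program sees only k' = min k M. If k > M, then q > 2 would give 2 ^ M <= (q - 1) ^ M <
         n < M, so q = 2 and the bound also holds for k. *)
      have qH' : q = 2%N \/ (q.-1 ^ k < n)%N.
        case: qH => [|H]; [by left|right].
        case: (leqP k M) => [kM|Mk]; first by rewrite /k' (minn_idPl kM) in H.
        have [q2|q2] := leqP q 2; first by rewrite (_ : q = 2) ?exp1n in H *; lia.
        move: H; rewrite /k' (minn_idPr (ltnW Mk)) => H.
        have : (2 ^ M <= q.-1 ^ M)%N by rewrite leq_exp2r; lia.
        by have := ltn_expl M (ltnSn 1); lia.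
      have q_le := root_le R n0 k0 qH'.
      rewrite -(ler_nat R) !natrM in card; apply: (le_trans card).
      rewrite powRD ?powRr1 ?ler0n //; last by rewrite pnatr_eq0 -lt0n n0 implybT.
      have P6 : 6 <= (polylog B n)%:R :> R by rewrite (ler_nat R 6); lia.
      set y := n%:R `^ _ in q_le *; have y0 : 0 <= y by exact: powR_ge0.
      have nn : 0 <= n%:R :> R by exact: ler0n.
      apply: (@le_trans _ _ (6 * (n%:R * y) * rho ^+ 2)); last first.
        have rho0 : 0 <= rho by lra.
        apply: ler_wpM2r; first exact: exprn_ge0.
        by apply: ler_wpM2r => //; exact: mulr_ge0.
      apply: (@le_trans _ _ (3 * (2 * y) * rho * n%:R)).
        by rewrite ler_wpM2r // ler_pM ?mulr_ge0 ?ler0n // ler_wpM2l ?ler0n.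
      have : rho <= rho ^+ 2 by rewrite expr2; nra.
      have : 0 <= n%:R * y by rewrite mulr_ge0.
      by nra.
exists T; split=> //.
  pose E := (\sum_u deg G u %/ r)%N.
  have hT : (T <= 240 * bitlen n * (n + E))%N.
    have : (\sum_(x | true) (quota G r (2 * m) x + 2) <= \sum_(x : 'I_n) ((deg G x %/ r).+1 * (2 * m) + 2))%N.
      apply: leq_sum => x _; rewrite leq_add2r leq_mul2r; apply/orP; right.
      by case: (0 < deg G x)%N; lia.
    have -> : (\sum_(x : 'I_n) ((deg G x %/ r).+1 * (2 * m) + 2) = (E + n) * (2 * m) + n * 2)%N.
      rewrite big_split /= sum_nat_const card_ord -big_distrl /=; congr (_ * _ + _)%N.
      rewrite /E -[X in _ = (_ + X)%N]card_ord -sum1_card -big_split /=.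
      by apply: eq_bigr => x _; rewrite addn1.
    by rewrite /T /budget /= add0n subn0; exact: time_arith.
  have hE : E%:R <= 4 * #|edges (adj G)|%:R / rho by exact: (sum_div_deg_le _ rho1 nM).
  set e := _ / rho in hE *; set e' := _ / rho.
  have Ee : e = 4 * e' by rewrite /e /e' mulrA.
  have e0 : 0 <= e' by rewrite divr_ge0 ?ler0n //; lra.
  have nn : 0 <= n%:R :> R by exact: ler0n.
  apply: (@le_trans _ _ ((240 * bitlen n)%:R * (n%:R + E%:R))).
    by rewrite -natrD -natrM ler_nat.
  apply: (@le_trans _ _ ((1000 * bitlen n)%:R * (n%:R + e'))); last first.
    by rewrite ler_wpM2r ?addr_ge0 ?ler_nat -?EB.
  rewrite !natrM; have : 0 <= (bitlen n)%:R :> R by exact: ler0n.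
  move: (bitlen n)%:R => b b0; rewrite -![_ * b * _]mulrA.
  have : b * (n%:R + E%:R) <= b * (4 * (n%:R + e')) by rewrite ler_wpM2l //; lra.
  have : 0 <= b * (n%:R + e') by rewrite mulr_ge0 ?addr_ge0.
  by lra.
(* The failure bound n (n + 1) / 2 ^ (3 [bitlen n]) is at most 1 / n, because n + 1 <= 2 ^
   [bitlen n]. *)
apply: le_trans pr; rewrite lerD2l lerN2 powRr1 ?ler0n // /eps /m.
have Hn : (n < 2 ^ bitlen n)%N by exact: trunc_log_ltn.
rewrite exprVn -natrX mulnC expnM mulrA ler_pdivrMr ?ltr0n ?expn_gt0 //.
rewrite ler_pdivlMl ?ltr0n // -!natrM ler_nat.
apply: (@leq_trans (n.+1 ^ 3)); last by rewrite leq_exp2r.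
by rewrite !expnS expn0; nia.
Qed.
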